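(* Let $T:\mathbb{R}^n\to\mathbb{R}^n$ be a $1$-Lipschitz map (with respect to the Euclidean norm $\|\cdot\|_2$). Then for every $\mathbb{R}^n$-valued random vector $X$ and every $s>0$, the inequality $$h_\alpha(X+\sqrt{s}\,Z)\;\ge\; h_\alpha(T(X)+\sqrt{s}\,Z)$$ holds for all $\alpha\in[1,\infty]$, and it also holds for all $\alpha\in[0,1)$ under the additional assumption that $\mathbb{E}\|X\|_2<\infty$. (For $\alpha=1$ the assertion includes that the integrals defining both sides exist, possibly with value $+\infty$.)
   Context: $Z$ denotes a standard Gaussian random vector in $\mathbb{R}^n$, with density $(2\pi)^{-n/2}e^{-\|x\|_2^2/2}$. All sums of random vectors are sums of independent random vectors; thus $Z$ is independent of $X$ (and of $T(X)$). The law of $X$ is arbitrary; it need not have a density. Rényi entropy: for an $\mathbb{R}^n$-valued random vector $W$ with density $f$ with respect to Lebesgue measure, and $\alpha\in(0,1)\cup(1,\infty)$, $$h_\alpha(W)=\frac{1}{1-\alpha}\log\int_{\mathbb{R}^n} f^\alpha\,dx .$$ For the remaining orders: $h_0(W)=\lim_{\alpha\to0^+}h_\alpha(W)=\log \mathrm{vol}(\mathrm{supp}(f))$, where $\mathrm{vol}$ is Lebesgue measure; $h_\infty(W)=\lim_{\alpha\to\infty}h_\alpha(W)=-\log\|f\|_\infty$; and $h_1(W)=-\int f\log f\,dx$ if this integral exists (the Shannon–Boltzmann entropy). Values in the extended reals are allowed. *)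

(* Defs.v *)
From HB Require Import structures.
From mathcomp Require Import all_boot all_order all_algebra.
From mathcomp Require Import all_classical all_reals all_analysis.

Set Implicit Arguments.
Unset Strict Implicit.
Unset Printing Implicit Defensive.

Import Order.TTheory GRing.Theory Num.Theory.
Import numFieldNormedType.Exports.

Local Open Scope classical_set_scope.
Local Open Scope ring_scope.

(* The sigma-algebra on R^n is the product one, generated by the coordinates;
   it coincides with the Borel sigma-algebra. *)
Fact rV_display : measure_display. Proof. exact: default_measure_display. Qed.

Section rV_measurable.
Variables (R : realType) (n : nat).

Definition rV_coord (i : 'I_n) (v : 'rV[R]_n) : measurableTypeR R := v ord0 i.

Let rV_set0 : g_sigma_preimage rV_coord set0.
Proof. exact: sigma_algebra0. Qed.

Let rV_setC A : g_sigma_preimage rV_coord A -> g_sigma_preimage rV_coord (~` A).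
Proof. exact: sigma_algebraC. Qed.

Let rV_bigcup (F : (set 'rV[R]_n)^nat) :
  (forall i, g_sigma_preimage rV_coord (F i)) ->
  g_sigma_preimage rV_coord (\bigcup_i F i).
Proof. exact: sigma_algebra_bigcup. Qed.

HB.instance Definition _ := @isMeasurable.Build rV_display
  'rV[R]_n (g_sigma_preimage rV_coord) rV_set0 rV_setC rV_bigcup.

End rV_measurable.

Lemma measurable_rV_coord (R : realType) n (i : 'I_n) :
  measurable_fun [set: 'rV[R]_n] (@rV_coord R n i).
Proof.
move=> _ Y mY; apply: sub_sigma_algebra.
by rewrite -bigcup_seq; exists i => /=; [rewrite mem_index_enum | exists Y].
Qed.

Lemma measurable_fun_rVP (R : realType) n d (T : measurableType d)
    (f : T -> 'rV[R]_n) :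
  measurable_fun [set: T] f <->
  forall i, measurable_fun [set: T] (@rV_coord R n i \o f).
Proof.
split=> [mf i|mf]; first exact: measurableT_comp (measurable_rV_coord i) mf.
have : g_sigma_preimage (fun i => @rV_coord R n i \o f) `<=` measurable.
  apply: smallest_sub; first exact: sigma_algebra_measurable.
  by rewrite -bigcup_seq => A [i _ [B mB <-]]; exact: mf.
by rewrite g_sigma_preimage_comp => s _ A mA; apply: s; exists A.
Qed.

Section lebesgue_measure_rV.
Variable R : realType.

Definition rV_cons n (p : measurableTypeR R * 'rV[R]_n) : 'rV[R]_n.+1 :=
  \row_i oapp (fun j => p.2 ord0 j) (p.1 : R) (unlift ord0 i).

Lemma measurable_rV_cons n : measurable_fun setT (@rV_cons n).
Proof.
apply/measurable_fun_rVP => i.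
case: (unliftP ord0 i) => [j ->|->].
- rewrite (_ : _ \o _ = rV_coord j \o snd); last first.
    by apply/funext => p; rewrite /= /rV_coord mxE liftK.
  exact: measurableT_comp (measurable_rV_coord j) measurable_snd.
- rewrite (_ : _ \o _ = fst) //.
  by apply/funext => p; rewrite /= /rV_coord mxE unlift_none.
Qed.

Section cons_measure.
Variables (n : nat) (m : {sigma_finite_measure set 'rV[R]_n -> \bar R}).

Definition cons_measure : set 'rV[R]_n.+1 -> \bar R :=
  pushforward (lebesgue_measure \x m)%E (@rV_cons n).

Let cons_measure0 : cons_measure set0 = 0%E.
Proof. by rewrite /cons_measure /pushforward preimage_set0 measure0. Qed.

Let cons_measure_ge0 A : (0 <= cons_measure A)%E.
Proof. by rewrite /cons_measure /pushforward measure_ge0. Qed.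

Let cons_measure_sigma_additive : semi_sigma_additive cons_measure.
Proof.
move=> F mF tF mUF; rewrite /cons_measure /pushforward preimage_bigcup.
have mc A : measurable A -> measurable (@rV_cons n @^-1` A).
  by move=> mA; rewrite -[X in measurable X]setTI; exact: measurable_rV_cons.
apply: measure_semi_sigma_additive.
- by move=> k; exact: mc.
- apply/trivIsetP => /= i j _ _ ij; rewrite -preimage_setI.
  by move/trivIsetP : tF => /(_ _ _ _ _ ij) ->//; rewrite preimage_set0.
- by rewrite -preimage_bigcup; exact: mc.
Qed.

HB.instance Definition _ := isMeasure.Build _ _ _ cons_measure
  cons_measure0 cons_measure_ge0 cons_measure_sigma_additive.

Let cons_measure_sigma_finite : sigma_finite setT cons_measure.
Proof.
have /sigma_finiteP[F [FT ndF Foo]] := sigma_finiteT (@lebesgue_measure R).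
have /sigma_finiteP[G [GT ndG Goo]] := sigma_finiteT m.
pose uncons (v : 'rV[R]_n.+1) : measurableTypeR R * 'rV[R]_n :=
  (rV_coord ord0 v, \row_j v ord0 (lift ord0 j)).
have muncons : measurable_fun setT uncons.
  apply/measurable_fun_pairP; split; first exact: measurable_rV_coord.
  apply/measurable_fun_rVP => j.
  rewrite (_ : _ \o _ = rV_coord (lift ord0 j)); last first.
    by apply/funext => v; rewrite /= /rV_coord mxE.
  exact: measurable_rV_coord.
have consK : cancel (@rV_cons n) uncons.
  move=> [x v]; rewrite /uncons /rV_cons /rV_coord mxE unlift_none; congr pair.
  by apply/rowP => j; rewrite !mxE liftK.
exists (fun k => uncons @^-1` (F k `*` G k)).
  rewrite -preimage_bigcup; apply/esym/seteqP; split=> // v _.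
  have [i _ Fi] : (\bigcup_i F i) (uncons v).1 by rewrite -FT.
  have [j _ Gj] : (\bigcup_i G i) (uncons v).2 by rewrite -GT.
  exists (maxn i j) => //; split.
    by move: Fi; exact/subsetPset/ndF/leq_maxl.
  by move: Gj; exact/subsetPset/ndG/leq_maxr.
move=> k; have [mF Fk] := Foo k; have [mG Gk] := Goo k; split.
  by rewrite -[X in measurable X]setTI; apply: muncons => //; exact: measurableX.
rewrite /cons_measure /pushforward -comp_preimage.
rewrite (_ : uncons \o _ = id); last by apply/funext => p; exact: consK.
by rewrite preimage_id product_measure1E// lte_mul_pinfty// ge0_fin_numE.
Qed.

HB.instance Definition _ := Measure_isSigmaFinite.Build _ _ _ cons_measure
  cons_measure_sigma_finite.

End cons_measure.

(* Lebesgue measure on R^n, as the iterated product of the one on R. *)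
Fixpoint lebesgue_rV n : {sigma_finite_measure set 'rV[R]_n -> \bar R} :=
  match n with
  | 0 => \d_(0 : 'rV[R]_0)
  | n'.+1 => cons_measure (lebesgue_rV n')
  end.

Lemma lebesgue_rV_box n (A : 'I_n -> set (measurableTypeR R)) :
  (forall i, measurable (A i)) ->
  lebesgue_rV n [set v | forall i, A i (v ord0 i)] =
  (\prod_(i < n) lebesgue_measure (A i))%E.
Proof.
elim: n A => [|n IHn] A mA.
  by rewrite big_ord0 /= diracE mem_set// => -[].
rewrite big_ord_recl -IHn; last by move=> i; exact: mA.
rewrite -product_measure1E//; last first.
  rewrite (_ : (fun _ => _) = \bigcap_(i in [set: 'I_n])
      (rV_coord i @^-1` A (lift ord0 i))); last first.
    by apply/seteqP; split=> [v vA i _|v vA i]; [exact: vA|exact: (vA i)].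
  apply: fin_bigcap_measurable => // i _.
  by rewrite -[X in measurable X]setTI; exact: measurable_rV_coord.
rewrite /= /cons_measure /pushforward; congr (product_measure1 _ _ _).
apply/seteqP; split=> -[x v] /= h.
  split; first by have := h ord0; rewrite mxE unlift_none.
  by move=> i; have := h (lift ord0 i); rewrite mxE liftK.
move=> i; rewrite mxE; case: (unliftP ord0 i) => [j ->|->] /=; last exact: h.1.
exact: h.2.
Qed.

End lebesgue_measure_rV.

Section euclidean.
Variables (R : realType) (n : nat).

(* The library's norm `|v| on 'rV[R]_n is the sup norm. *)
Definition norm2 (v : 'rV[R]_n) : R := Num.sqrt (\sum_i v ord0 i ^+ 2).

Definition lipschitz1 (T : 'rV[R]_n -> 'rV[R]_n) : Prop :=
  forall x y, norm2 (T x - T y) <= norm2 (x - y).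

Definition gauss_density (x : 'rV[R]_n) : R :=
  (2 * pi) `^ (- (n%:R / 2)) * expR (- (norm2 x ^+ 2 / 2)).

End euclidean.

Section random_vectors.
Context d (Omega : measurableType d) (R : realType) (P : probability Omega R).
Variable n : nat.
Implicit Types (W : Omega -> 'rV[R]_n) (f : 'rV[R]_n -> R).
Local Open Scope ereal_scope.

Definition independent_RV (X Y : Omega -> 'rV[R]_n) : Prop :=
  forall A B, measurable A -> measurable B ->
    P (X @^-1` A `&` Y @^-1` B) = P (X @^-1` A) * P (Y @^-1` B).

Definition is_density W f : Prop :=
  [/\ measurable_fun setT f,
      (forall x, 0 <= f x)%R &
      forall A, measurable A ->
        P (W @^-1` A) = \int[lebesgue_rV R n]_(x in A) (f x)%:E].

Definition has_density W : Prop := exists f, is_density W f.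

(* An arbitrary version of the density; the zero function if there is none. *)
Definition density W : 'rV[R]_n -> R := xget (cst 0%R) (is_density W).

Definition standard_gaussian W : Prop := is_density W (@gauss_density R n).

(* Since ln 0 = 0 in the library, the integrand f log f vanishes where f does. *)
Definition shannon_integrand W (x : 'rV[R]_n) : \bar R :=
  (density W x * ln (density W x))%:E.

(* The library's integral is total, with +oo - oo = -oo: the integral exists, as
   an extended real, when the positive or the negative part is integrable. *)
Definition shannon_integral_exists W : Prop :=
  \int[lebesgue_rV R n]_x (shannon_integrand W)^\+ x < +oo \/
  \int[lebesgue_rV R n]_x (shannon_integrand W)^\- x < +oo.

(* The order a ranges over [0, +oo]; the value at other a is irrelevant.
   In order 0, supp f is the set where f does not vanish, which is what makes
   log vol (supp f) the limit of the entropies of positive order. *)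
Definition renyi_entropy (a : \bar R) W : \bar R :=
  match a with
  | +oo => - lne (Lnorm (lebesgue_rV R n) +oo (EFin \o density W))
  | a%:E =>
      if a == 0%R then
        lne (lebesgue_rV R n [set x | density W x != 0%R])
      else if a == 1%R then
        - \int[lebesgue_rV R n]_x shannon_integrand W x
      else
        ((1 - a)^-1)%:E * lne (\int[lebesgue_rV R n]_x (density W x `^ a)%:E)
  | -oo => 0
  end.

End random_vectors.

(* Main.v *)
Require Import Defs.
From HB Require Import structures.
From mathcomp Require Import all_boot all_order all_algebra.
From mathcomp Require Import all_classical all_reals all_analysis.
From mathcomp Require Import measurable_realfun ess_sup_inf.
From mathcomp Require Import ring lra.

Set Implicit Arguments.
Unset Strict Implicit.
Unset Printing Implicit Defensive.

Import Order.TTheory GRing.Theory Num.Theory.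
Import numFieldNormedType.Exports.

Local Open Scope classical_set_scope.
Local Open Scope ring_scope.

(**
Up to a constant that depends only on n and s, the density f_X of X + sqrt s Z is
u |-> E [gauss (u - X)], where gauss u = exp (- |u|^2 / (2 s)).  Everything follows
from comparing, for each real a > 0, the integrals of f_X^a and of f_{T X}^a: the
former is the smaller one for a >= 1 and the larger one for a <= 1
(contraction_powR).

Finitely many values.  Let X take the values x_i with probability p_i, and put
y_i = T x_i.  The points z_i(t) = (cos t x_i, sin t y_i) of R^n x R^n join
(x_i, 0) to (0, y_i) when t runs over [0, pi / 2], and all their mutual
distances decrease, because |y_i - y_j| <= |x_i - x_j|.  Let v_i be the
velocity of z_i, let f = sum_i p_i gauss (. - z_i) and
w = sum_i p_i v_i gauss (. - z_i).  With beta = 1 / (2 s) and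
q_i = p_i gauss (. - z_i), a direct computation (dpmix_div) gives the pointwise
identity
  d/dt f^a + div (f^(a-1) w)
    = - (a - 1) beta f^(a-2) sum_(i, j) q_i q_j <z_i - z_j, v_i - v_j>,
where no inner product is positive, being half the time derivative of
|z_i - z_j|^2.
The divergence integrates to zero, so the integral of f^a over R^n x R^n is
nondecreasing in t for a >= 1 and nonincreasing for a <= 1 (contraction_path).
At both ends the Gaussian splits as a product, and this integral is that of
f_X^a, respectively of f_{T X}^a, times one and the same positive constant
(finite_contraction).

General X.  On the event that all the coordinates of X are at most K in absolute
value, X is the limit of quantizations with finitely many values; the densities
are dominated by a fixed Gaussian, and the comparison passes to the limit
(contraction_bounded).  Letting K grow, it passes to the limit again by monotone
convergence.

Entropies.  For a different from 0, 1 and +oo, the sign of 1 - a turns the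
comparison into the inequality of entropies.  In order 1, for f bounded by C and
K = C ln C, the functions K f - f (f^e - 1) / e, for 0 < e <= 1, are nonnegative and
increase to K f - f ln f as e decreases to 0; Fatou's lemma for f = f_{T X} and this upper
bound for f = f_X give the inequality (neg_entropy_gap_le).  The same
bound K f >= f ln f shows that both entropies exist and are not -oo.  In order
+oo, Markov's inequality
  m^a vol {f_X > m} <= integral of f_X^a <= integral of f_{T X}^a <= M^(a-1),
where M is the essential supremum of f_{T X} and m > M, forces
vol {f_X > m} = 0 as a tends to +oo (le_Lnorm_oo).  In order 0 both densities are
positive everywhere, so both entropies are log vol R^n.
*)

(** * Lebesgue measure on R^n and Gaussian integrals *)

Lemma lebesgue_affine1 (R : realType) (a r : R) (h : measurableTypeR R -> \bar R) : 0 < r ->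
  measurable_fun setT h -> (forall x, 0 <= h x)%E ->
  (\int[lebesgue_measure]_x h x = r%:E * \int[lebesgue_measure]_x h (a + r * x)%R)%E.
Proof.
move=> r0 mh h0.
pose phi (x : measurableTypeR R) : measurableTypeR R := a + r * x.
have mphi : measurable_fun setT phi.
  by apply: measurable_funD => //; apply: measurable_funM.
have r0' : 0 <= r by exact: ltW.
pose mu0 : {measure set (measurableTypeR R) -> \bar R} :=
  mscale (NngNum r0') (pushforward (@lebesgue_measure R) phi).
pose mu' := mu0 mphi.
rewrite (@eq_measure_integral _ _ _ setT mu'); last first.
  move=> A mA _; apply: lebesgue_measure_unique => //.
  move=> _ [[u v] _ <-] /=.
  rewrite /mu' /mscale/= /pushforward.
  have -> : phi @^-1` `]u, v] = `](u - a) / r, (v - a) / r]%classic.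
    apply/seteqP; split => x /=; rewrite !in_itv/= /phi ltr_pdivrMr// ler_pdivlMr//;
    by rewrite ltrBlDl lerBrDl (mulrC x).
  rewrite !lebesgue_measure_itv/= !lte_fin ltr_pM2r ?invr_gt0// ltrD2r.
  case: ifPn => // _; last by rewrite mule0.
  by rewrite -!EFinB -EFinM; congr EFin; field; rewrite gt_eqF.
rewrite ge0_integral_mscale//; congr (_ * _)%E.
by rewrite ge0_integral_pushforward.
Qed.

Section rV_integration.
Variable R : realType.
Implicit Types (n m : nat).

Lemma integral_rV_cons n (h : 'rV[R]_n.+1 -> \bar R) :
  measurable_fun setT h -> (forall x, 0 <= h x)%E ->
  (\int[lebesgue_rV R n.+1]_x h x =
   \int[lebesgue_measure]_x \int[lebesgue_rV R n]_v h (rV_cons (x, v)))%E.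
Proof.
move=> mh h0.
pose mu0 : {measure set 'rV[R]_n.+1 -> \bar R} :=
  pushforward (@lebesgue_measure R \x lebesgue_rV R n)%E (@rV_cons R n).
rewrite (@eq_measure_integral _ _ _ setT (mu0 (@measurable_rV_cons R n)))//.
rewrite ge0_integral_pushforward//; last exact: measurable_rV_cons.
rewrite preimage_setT fubini_tonelli1//.
  by apply: measurableT_comp => //; exact: measurable_rV_cons.
by move=> x; exact: h0.
Qed.

Lemma measurable_rV_cons_tail n (x : R) :
  measurable_fun setT (fun v : 'rV[R]_n => rV_cons (x, v)).
Proof.
apply: (measurableT_comp (@measurable_rV_cons R n)).
exact: measurable_pair1.
Qed.

Lemma measurable_rV_affine n (a : 'rV[R]_n) (r : R) :
  measurable_fun setT (fun z : 'rV[R]_n => a + r *: z).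
Proof.
apply/measurable_fun_rVP => i; rewrite /comp /rV_coord.
under eq_fun do rewrite !mxE.
apply: measurable_funD => //; apply: measurable_funM => //.
exact: measurable_rV_coord.
Qed.

(** Change of variables for homotheties composed with translations. *)
Lemma lebesgue_rV_affine n (a : 'rV[R]_n) (r : R) (h : 'rV[R]_n -> \bar R) :
  0 < r -> measurable_fun setT h -> (forall x, 0 <= h x)%E ->
  (\int[lebesgue_rV R n]_x h x =
   (r ^+ n)%:E * \int[lebesgue_rV R n]_x h (a + r *: x)%R)%E.
Proof.
move=> r0; elim: n a h => [|n IHn] a h mh h0.
  rewrite expr0 mul1e; apply: eq_integral => x _.
  by congr h; apply/rowP => -[].
have E x v : a + r *: rV_cons (x, v) =
    rV_cons (a ord0 ord0 + r * x, (\row_j a ord0 (lift ord0 j)) + r *: v).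
  apply/rowP => j; rewrite !mxE.
  by case: (unliftP ord0 j) => [k ->|->]; rewrite /= ?liftK ?unlift_none/= ?mxE.
rewrite integral_rV_cons//.
rewrite (lebesgue_affine1 (a ord0 ord0) r0); first last.
- by move=> x; apply: integral_ge0 => v _; exact: h0.
- apply: (@measurable_fun_fubini_tonelli_F _ _ _ _ _ (lebesgue_rV R n)
    (fun p => h (rV_cons p))) => //.
  by apply: measurableT_comp => //; exact: measurable_rV_cons.
rewrite integral_rV_cons//; last first.
  by apply: measurableT_comp => //; exact: measurable_rV_affine.
rewrite exprS EFinM -muleA; congr (_ * _)%E.
rewrite -ge0_integralZl//; first last.
- by rewrite lee_fin exprn_ge0// ltW.
- by move=> x _; apply: integral_ge0 => v _; exact: h0.
- apply: (@measurable_fun_fubini_tonelli_F _ _ _ _ _ (lebesgue_rV R n)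
    (fun p => h (a + r *: rV_cons p))) => //.
  apply: (measurableT_comp mh).
  apply: (measurableT_comp (measurable_rV_affine _ _)).
  exact: measurable_rV_cons.
apply: eq_integral => x _.
rewrite (IHn (\row_j a ord0 (lift ord0 j)))//; last first.
  by apply: measurableT_comp => //; exact: measurable_rV_cons_tail.
by congr (_ * _)%E; apply: eq_integral => v _; rewrite E.
Qed.

Lemma measurable_lsubmx n m :
  measurable_fun setT (@lsubmx R 1 n m : 'rV[R]_(n + m) -> 'rV[R]_n).
Proof.
apply/measurable_fun_rVP => i; rewrite /comp /rV_coord.
by under eq_fun do rewrite !mxE; exact: measurable_rV_coord.
Qed.

Lemma measurable_rsubmx n m :
  measurable_fun setT (@rsubmx R 1 n m : 'rV[R]_(n + m) -> 'rV[R]_m).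
Proof.
apply/measurable_fun_rVP => i; rewrite /comp /rV_coord.
by under eq_fun do rewrite !mxE; exact: measurable_rV_coord.
Qed.

Lemma lsubmx_rV_cons n m (x : R) (v : 'rV[R]_(n + m)) :
  lsubmx (rV_cons (x, v) : 'rV[R]_(n.+1 + m)) = rV_cons (x, lsubmx v).
Proof.
apply/rowP => j; rewrite !mxE.
case: (unliftP ord0 j) => [k ->|->].
  rewrite (_ : lshift m (lift ord0 k) = lift ord0 (lshift m k) :> 'I_(n + m).+1) ?liftK/= ?mxE//.
  exact: val_inj.
rewrite (_ : lshift m ord0 = ord0 :> 'I_(n + m).+1) ?unlift_none//.
exact: val_inj.
Qed.

Lemma rsubmx_rV_cons n m (x : R) (v : 'rV[R]_(n + m)) :
  rsubmx (rV_cons (x, v) : 'rV[R]_(n.+1 + m)) = rsubmx v.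
Proof.
apply/rowP => j; rewrite !mxE.
rewrite (_ : rshift n.+1 j = lift ord0 (rshift n j) :> 'I_(n + m).+1) ?liftK/= ?mxE//.
exact: val_inj.
Qed.

(** On R^(n + m), the integral of a product of functions of the two blocks of
coordinates factors. *)
Lemma lebesgue_rV_split n m (F : 'rV[R]_n -> \bar R) (G : 'rV[R]_m -> \bar R) :
  measurable_fun setT F -> measurable_fun setT G ->
  (forall x, 0 <= F x)%E -> (forall x, 0 <= G x)%E ->
  (\int[lebesgue_rV R (n + m)]_x (F (lsubmx x) * G (rsubmx x)) =
   (\int[lebesgue_rV R n]_x F x) * \int[lebesgue_rV R m]_x G x)%E.
Proof.
move=> mF mG F0 G0.
have mFG k (H : 'rV[R]_k -> \bar R) : measurable_fun setT H ->
   measurable_fun setT (fun z : 'rV[R]_(k + m) => (H (lsubmx z) * G (rsubmx z))%E).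
  move=> mH; apply: emeasurable_funM.
    by apply: (measurableT_comp mH); exact: measurable_lsubmx.
  by apply: (measurableT_comp mG); exact: measurable_rsubmx.
have IG0 : (0 <= \int[lebesgue_rV R m]_x G x)%E by exact: integral_ge0.
elim: n F mF F0 => [|n IHn] F mF F0.
  rewrite [in RHS]integral_dirac// diracE mem_set// mul1e.
  rewrite -ge0_integralZl//.
  apply: eq_integral => x _.
  congr (_ * _)%E; first by congr F; apply/rowP => -[].
  by congr G; apply/rowP => j; rewrite mxE; congr (x _ _); exact: val_inj.
rewrite (@integral_rV_cons (n + m))//; first last.
- by move=> x; exact: mule_ge0.
- exact: (mFG n.+1 F).
rewrite integral_rV_cons// -ge0_integralZr//; first last.
- by move=> x _; apply: integral_ge0 => v _; exact: F0.
- apply: (@measurable_fun_fubini_tonelli_F _ _ _ _ _ (lebesgue_rV R n)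
    (fun p => F (rV_cons p))) => //.
  by apply: measurableT_comp => //; exact: measurable_rV_cons.
apply: eq_integral => x _.
rewrite -(IHn (fun v => F (rV_cons (x, v))))//.
  by apply: eq_integral => v _; rewrite lsubmx_rV_cons rsubmx_rV_cons.
by apply: measurableT_comp => //; exact: measurable_rV_cons_tail.
Qed.

(** The squared Euclidean norm. *)
Definition sqnorm n (v : 'rV[R]_n) : R := \sum_i v ord0 i ^+ 2.

Lemma sqnorm_ge0 n (v : 'rV[R]_n) : 0 <= sqnorm v.
Proof. by apply: sumr_ge0 => i _; exact: sqr_ge0. Qed.

Lemma norm2_sqr n (v : 'rV[R]_n) : norm2 v ^+ 2 = sqnorm v.
Proof. by rewrite sqr_sqrtr// sqnorm_ge0. Qed.

Lemma measurable_sqnorm n : measurable_fun setT (@sqnorm n).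
Proof.
apply: measurable_sum => i.
by apply: measurable_funX; exact: measurable_rV_coord.
Qed.

(** The Gaussian function exp (- e |v|^2), not normalised.  The parameter e may
have any sign: gauss (- e) serves as a majorant of polynomials. *)
Definition gauss n (e : R) (v : 'rV[R]_n) : R := expR (- (e * sqnorm v)).

Lemma gauss_gt0 n e (v : 'rV[R]_n) : 0 < gauss e v.
Proof. exact: expR_gt0. Qed.

Lemma gauss_ge0 n e (v : 'rV[R]_n) : 0 <= gauss e v.
Proof. exact: expR_ge0. Qed.

Lemma measurable_gauss n e : measurable_fun setT (@gauss n e).
Proof.
apply: measurableT_comp => //; apply: measurableT_comp => //.
by apply: measurable_funM => //; exact: measurable_sqnorm.
Qed.

Lemma gauss_integral1 (e : R) : 0 < e -> exists2 c : R, 0 < c &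
  (\int[lebesgue_measure]_x (expR (- (e * x ^+ 2)))%:E = c%:E)%E.
Proof.
move=> e0; pose s := (Num.sqrt (e *+ 2))^-1.
have s0 : s != 0 by rewrite invr_neq0// gt_eqF// sqrtr_gt0 mulrn_wgt0.
exists (normal_peak s)^-1; first by rewrite invr_gt0 normal_peak_gt0.
have p0 := normal_peak_gt0 s0.
have E x : expR (- (e * x ^+ 2)) = (normal_peak s)^-1 * normal_pdf 0 s x.
  rewrite normal_pdfE// mulKf ?gt_eqF// /normal_fun subr0; congr expR.
  rewrite exprVn sqr_sqrtr ?mulrn_wge0 ?ltW//; field.
  by rewrite gt_eqF.
under eq_integral do rewrite E EFinM.
rewrite ge0_integralZl//; first last.
- by rewrite lee_fin invr_ge0 ltW.
- by move=> x _; rewrite lee_fin normal_pdf_ge0.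
- by apply/measurable_EFinP; exact: measurable_normal_pdf.
by rewrite integral_normal_pdf// mule1.
Qed.

(** The value of the integral plays no role beyond being positive and finite. *)
Lemma gauss_integral n (e : R) : 0 < e -> exists2 c : R, 0 < c &
  (\int[lebesgue_rV R n]_x (gauss e x)%:E = c%:E)%E.
Proof.
move=> e0; have [c1 c10 Ec1] := gauss_integral1 e0.
elim: n => [|n [c c0 IHn]].
  exists 1 => //; rewrite integral_dirac ?diracE ?mem_set ?mul1e//; last first.
    by apply/measurable_EFinP; exact: measurable_gauss.
  by rewrite /gauss /sqnorm big_ord0 mulr0 oppr0 expR0.
exists (c1 * c); first exact: mulr_gt0.
rewrite integral_rV_cons; first last.
- by move=> x; rewrite lee_fin gauss_ge0.
- by apply/measurable_EFinP; exact: measurable_gauss.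
have E x (v : 'rV[R]_n) : gauss e (rV_cons (x, v)) = expR (- (e * x ^+ 2)) * gauss e v.
  rewrite /gauss -expRD -opprD -mulrDr /sqnorm big_ord_recl; congr (expR (- (e * _))).
  congr (_ + _); first by rewrite mxE unlift_none.
  by apply: eq_bigr => i _; rewrite mxE liftK.
have I x : (\int[lebesgue_rV R n]_v (gauss e (rV_cons (x, v)))%:E =
    (expR (- (e * x ^+ 2)))%:E * c%:E)%E.
  under eq_integral do rewrite E EFinM.
  rewrite ge0_integralZl ?IHn//.
  - by apply/measurable_EFinP; exact: measurable_gauss.
  - by move=> v _; rewrite lee_fin gauss_ge0.
under eq_integral do rewrite I.
rewrite ge0_integralZr//; last by rewrite lee_fin ltW.
- by rewrite Ec1 EFinM.
- apply/measurable_EFinP; apply: measurableT_comp => //.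
  by apply: measurableT_comp => //; apply: measurable_funM => //; exact: measurable_funX.
Qed.

Lemma integrable_gauss n (e : R) : 0 < e ->
  (lebesgue_rV R n).-integrable setT (EFin \o @gauss n e).
Proof.
move=> e0; apply/integrableP; split.
  by apply/measurable_EFinP; exact: measurable_gauss.
under eq_integral do rewrite gee0_abs ?lee_fin ?gauss_ge0//.
by have [c _ ->] := gauss_integral n e0; rewrite ltry.
Qed.

Lemma lebesgue_rV_shift n (a : 'rV[R]_n) (h : 'rV[R]_n -> \bar R) :
  measurable_fun setT h ->
  (\int[lebesgue_rV R n]_x h x = \int[lebesgue_rV R n]_x h (x + a)%R)%E.
Proof.
move=> mh.
have sh f : measurable_fun setT f -> (forall x, 0 <= f x)%E ->
    (\int[lebesgue_rV R n]_x f x = \int[lebesgue_rV R n]_x f (x + a)%R)%E.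
  move=> mf f0; rewrite (lebesgue_rV_affine a (@ltr01 R) mf f0) expr1n mul1e.
  by apply: eq_integral => x _; rewrite scale1r addrC.
rewrite integralE [RHS]integralE; congr (_ - _)%E.
- rewrite (sh (funepos h)); first by apply: eq_integral => x _; rewrite !funeposE.
  + exact: measurable_funepos.
  + exact: funepos_ge0.
- rewrite (sh (funeneg h)); first by apply: eq_integral => x _; rewrite !funenegE.
  + exact: measurable_funeneg.
  + exact: funeneg_ge0.
Qed.

End rV_integration.

(** * Moving the centres of a Gaussian mixture *)
Lemma is_derive_bigsum (R : realType) (I : Type) (s : seq I) (h : I -> R -> R)
    (dh : I -> R) (x : R) : (forall i, is_derive x 1 (h i) (dh i)) ->
  is_derive x 1 (fun t => \sum_(i <- s) h i t) (\sum_(i <- s) dh i).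
Proof.
move=> H; elim: s => [|i s IHs].
  rewrite big_nil; under eq_fun do rewrite big_nil; exact: is_derive_cst.
rewrite big_cons; under eq_fun do rewrite big_cons.
exact: is_deriveD.
Qed.

Lemma Rintegral_le0 d (T : measurableType d) (R : realType)
    (mu : {measure set T -> \bar R}) (f : T -> R) :
  (forall x, f x <= 0) -> \int[mu]_x f x <= 0.
Proof.
move=> f0; rewrite /Rintegral.
under eq_integral => x _ do rewrite -[f x]opprK EFinN.
rewrite integral_ge0N; last by move=> x _; rewrite lee_fin oppr_ge0.
by rewrite fineN oppr_le0 fine_ge0// integral_ge0// => x _; rewrite lee_fin oppr_ge0.
Qed.

Section gaussian_mixtures.
Variables (R : realType) (I : finType) (N : nat) (beta : R).
Hypothesis beta_gt0 : 0 < beta.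
Implicit Types (r p : I -> R) (z v : I -> 'rV[R]_N) (x : 'rV[R]_N).

(** The Euclidean inner product. *)
Definition dotv n (a b : 'rV[R]_n) : R := \sum_k a ord0 k * b ord0 k.

(** The mixture sum_i r_i gauss (x - z_i) of Gaussians centred at z_i; the weights
r_i may be negative. *)
Definition mix r z x : R := \sum_i r i * gauss beta (x - z i).

(** The derivative of mix r z x in time when each centre z_i moves with velocity
v_i. *)
Definition dmix r z v x : R :=
  \sum_i r i * gauss beta (x - z i) * (2 * beta * dotv (x - z i) (v i)).

Lemma is_derive_gauss (z : R -> 'rV[R]_N) (v : 'rV[R]_N) (t : R) x :
  (forall k, is_derive t 1 (fun t => z t ord0 k) (v ord0 k)) ->
  is_derive t 1 (fun t => gauss beta (x - z t))
    (gauss beta (x - z t) * (2 * beta * dotv (x - z t) v)).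
Proof.
move=> zv.
have H k : is_derive t 1 (fun t => (x - z t) ord0 k ^+ 2)
    (- (2 * ((x - z t) ord0 k * v ord0 k))).
  have -> : (fun t => (x - z t) ord0 k ^+ 2) =
            (fun t => (x ord0 k - z t ord0 k) ^+ 2).
    by apply/funext => u; rewrite !mxE.
  have zvk := zv k.
  apply: is_derive_eq; rewrite !mxE /GRing.scale/=; ring.
have S : is_derive t 1 (fun t => sqnorm (x - z t))
    (\sum_k - (2 * ((x - z t) ord0 k * v ord0 k))).
  exact: is_derive_bigsum.
rewrite /gauss.
have -> : (fun t => expR (- (beta * sqnorm (x - z t)))) =
          expR \o (fun t => - (beta * sqnorm (x - z t))) by [].
apply: is_derive_eq.
rewrite sumrN -mulr_sumr; congr (_ * _).
by rewrite scalerN opprK /GRing.scale/= mulrA (mulrC beta).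
Qed.

Lemma is_derive_mix r (z : R -> I -> 'rV[R]_N) v (t : R) x :
  (forall i k, is_derive t 1 (fun t => z t i ord0 k) (v i ord0 k)) ->
  is_derive t 1 (fun t => mix r (z t) x) (dmix r (z t) v x).
Proof.
move=> zv; apply: is_derive_bigsum => i.
have := @is_derive_gauss (fun t => z t i) (v i) t x (zv i) => H.
by rewrite -mulrA; exact: (is_deriveZ (r i)).
Qed.

(** The function f^(a-1) g, where f and g are the mixtures of weights p and r with
the same centres.  For r = p it is f^a; for the weights p_i v_i^k it is the k-th
component of the vector field f^(a-1) w with w = sum_i p_i v_i gauss (. - z_i). *)
Definition pmix (a : R) p r z x : R := mix p z x `^ (a - 1) * mix r z x.

(** The derivative of pmix a p r z x in time when each centre z_i moves with
velocity v_i.  When r = p, it is the derivative of f^a. *)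
Definition dpmix (a : R) p r z v x : R :=
  (a - 1) * mix p z x `^ (a - 2) * dmix p z v x * mix r z x +
  mix p z x `^ (a - 1) * dmix r z v x.

Variable p : I -> R.
Hypothesis p_ge0 : forall i, 0 <= p i.
Hypothesis p_gt0 : exists i, 0 < p i.

Lemma mix_gt0 z x : 0 < mix p z x.
Proof.
have [i pi0] := p_gt0; rewrite /mix (bigD1 i)//=.
rewrite ltr_pwDl ?mulr_gt0 ?gauss_gt0//.
by apply: sumr_ge0 => j _; rewrite mulr_ge0 ?gauss_ge0.
Qed.

Lemma norm_mix_le r z x (B : R) : (forall i, `|r i| <= B * p i) ->
  `|mix r z x| <= B * mix p z x.
Proof.
move=> rB; rewrite (le_trans (ler_norm_sum _ _ _))// mulr_sumr ler_sum// => i _.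
by rewrite normrM (ger0_norm (gauss_ge0 _ _)) mulrA ler_wpM2r ?gauss_ge0.
Qed.

Lemma norm_dotv_le x (z v : 'rV[R]_N) (B : R) : 0 <= B ->
  (forall k, `|z ord0 k| <= B) -> (forall k, `|v ord0 k| <= B) ->
  `|2 * beta * dotv (x - z) v| <=
    2 * beta * B * (1 + N%:R * (1 + B)) * (1 + sqnorm x).
Proof.
move=> B0 zB vB.
have b0 : 0 < 2 * beta by rewrite mulr_gt0.
rewrite normrM (gtr0_norm b0) -!(mulrA (2 * beta)) ler_pM2l//.
rewrite (@le_trans _ _ (\sum_k (B * (1 + x ord0 k ^+ 2 + B))))//.
  rewrite (le_trans (ler_norm_sum _ _ _))// ler_sum// => k _.
  rewrite normrM mulrC ler_pM// !mxE.
  rewrite (le_trans (ler_normB _ _))// lerD//.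
  have := sqr_ge0 (`|x ord0 k| - 1); rewrite -(real_normK (num_real (x ord0 k))).
  move: (`|_|) => s; nra.
rewrite -mulr_sumr -mulrA ler_wpM2l//.
under eq_bigr do rewrite addrAC.
rewrite big_split/= sumr_const card_ord -/(sqnorm x) -[(1 + B) *+ N]mulr_natl.
have := sqnorm_ge0 x; have : 0 <= N%:R * (1 + B) by rewrite mulr_ge0// addr_ge0.
move: (N%:R * (1 + B)) (sqnorm x) => c d c0 d0; nra.
Qed.

Lemma norm_dmix_le r z v x (B C : R) : 0 <= B -> 0 <= C -> (forall i, `|r i| <= C * p i) ->
  (forall i k, `|z i ord0 k| <= B) -> (forall i k, `|v i ord0 k| <= B) ->
  `|dmix r z v x| <= C * (2 * beta * B * (1 + N%:R * (1 + B)) * (1 + sqnorm x)) * mix p z x.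
Proof.
move=> B0 C0 rC zB vB.
rewrite (le_trans (ler_norm_sum _ _ _))// mulr_sumr ler_sum// => i _.
rewrite 2!normrM (ger0_norm (gauss_ge0 _ _)).
rewrite [leRHS](_ : _ = (C * p i * gauss beta (x - z i)) *
  (2 * beta * B * (1 + N%:R * (1 + B)) * (1 + sqnorm x))); last by ring.
apply: ler_pM => //; first by rewrite mulr_ge0 ?gauss_ge0.
  by rewrite ler_wpM2r ?gauss_ge0.
exact: norm_dotv_le.
Qed.

Lemma gauss_shift_le x (z : 'rV[R]_N) (B : R) : (forall k, `|z ord0 k| <= B) ->
  gauss beta (x - z) <= expR (beta * (N%:R * B ^+ 2)) * gauss (beta / 2) x.
Proof.
move=> zB; rewrite /gauss -expRD ler_expR.
rewrite [X in _ <= X](_ : _ = beta * (N%:R * B ^+ 2 - sqnorm x / 2)); last by field.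
rewrite -mulrN ler_pM2l// lerBrDr -lerBrDl opprK.
rewrite /sqnorm mulr_suml.
have -> : N%:R * B ^+ 2 = \sum_(k < N) B ^+ 2.
  by rewrite sumr_const card_ord mulr_natl.
rewrite -big_split/= ler_sum// => k _; rewrite !mxE.
have : z ord0 k ^+ 2 <= B ^+ 2.
  by rewrite -(real_normK (num_real (z _ _))) lerXn2r// ?nnegrE// (le_trans _ (zB k)).
move: (x ord0 k) (z ord0 k) => s t tB.
have := sqr_ge0 (s - 2 * t); nra.
Qed.

Lemma mix_le_gauss z x (B : R) : (forall i k, `|z i ord0 k| <= B) ->
  mix p z x <= (\sum_i p i) * expR (beta * (N%:R * B ^+ 2)) * gauss (beta / 2) x.
Proof.
move=> zB; rewrite -mulrA mulr_suml ler_sum// => i _.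
by rewrite ler_wpM2l// gauss_shift_le.
Qed.

Lemma gauss_powR (e a : R) x : gauss e x `^ a = gauss (a * e) x.
Proof.
rewrite /powR gt_eqF ?gauss_gt0// /gauss expRK; congr expR.
by rewrite mulrN mulrA.
Qed.

Lemma poly_le_gauss (e : R) x : 0 < e ->
  1 + sqnorm x <= (1 + e^-1) * gauss (- e) x.
Proof.
move=> e0; rewrite /gauss mulNr opprK.
rewrite (@le_trans _ _ ((1 + e^-1) * (1 + e * sqnorm x)))//; last first.
  by rewrite ler_wpM2l ?expR_ge1Dx// addr_ge0// invr_ge0 ltW.
rewrite mulrDl mul1r mulrDr mulr1 mulKf ?gt_eqF//.
have : 0 <= e^-1 by rewrite invr_ge0 ltW.
have := mulr_ge0 (ltW e0) (sqnorm_ge0 x); lra.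
Qed.

Lemma mix_powR_le (a B : R) : 0 < a -> exists2 C : R, 0 <= C & forall z x,
  (forall i k, `|z i ord0 k| <= B) ->
  mix p z x `^ a * (1 + sqnorm x) <= C * gauss (a * beta / 4) x.
Proof.
move=> a0; pose C1 := (\sum_i p i) * expR (beta * (N%:R * B ^+ 2)).
have C10 : 0 <= C1 by rewrite mulr_ge0 ?expR_ge0// sumr_ge0.
have d0 : 0 < a * beta / 4 by rewrite divr_gt0// mulr_gt0.
exists (C1 `^ a * (1 + (a * beta / 4)^-1)).
  by rewrite mulr_ge0 ?powR_ge0// addr_ge0// invr_ge0 ltW.
move=> z x zB.
rewrite (@le_trans _ _ (C1 `^ a * gauss (a * (beta / 2)) x *
   ((1 + (a * beta / 4)^-1) * gauss (- (a * beta / 4)) x)))//.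
  apply: ler_pM => //; first exact: powR_ge0.
  - by rewrite addr_ge0// sqnorm_ge0.
  - rewrite -gauss_powR -powRM ?gauss_ge0//.
    apply: ge0_ler_powR; first exact: ltW.
    - by rewrite nnegrE ltW// mix_gt0.
    - by rewrite nnegrE mulr_ge0// gauss_ge0.
    - exact: mix_le_gauss.
  - exact: poly_le_gauss.
rewrite le_eqVlt; apply/orP; left; apply/eqP.
rewrite mulrACA; congr (_ * _); rewrite /gauss -expRD; congr expR.
by field.
Qed.

Lemma powR_mul2 (f a : R) : 0 < f -> f `^ (a - 2) * f * f = f `^ a.
Proof.
move=> f0; have fN0 : f != 0 by rewrite gt_eqF.
rewrite powRB ?fN0 ?implybT// (powR_mulrn 2) ?(ltW f0)// -mulrA -expr2.
by rewrite mulfVK// expf_neq0.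
Qed.

Lemma powR_mul1 (f a : R) : 0 < f -> f `^ (a - 1) * f = f `^ a.
Proof.
move=> f0; have fN0 : f != 0 by rewrite gt_eqF.
by rewrite powRB ?fN0 ?implybT// powRr1 ?(ltW f0)// mulfVK.
Qed.

(** A Gaussian majorant that is uniform over bounded centres and velocities: the
dominating function for differentiation under the integral sign.  A power of f
is at most a Gaussian, and the factors 1 + |x|^2 due to the velocities are
absorbed by passing from the exponent a beta / 2 to a beta / 4. *)
Lemma pmix_bound (a B : R) : 0 < a -> 0 <= B -> exists2 C : R, 0 <= C &
  forall r z v x, (forall i, `|r i| <= B * p i) ->
  (forall i k, `|z i ord0 k| <= B) -> (forall i k, `|v i ord0 k| <= B) ->
  `|pmix a p r z x| <= C * gauss (a * beta / 4) x /\
  `|dpmix a p r z v x| <= C * gauss (a * beta / 4) x.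
Proof.
move=> a0 B0; have [C C0 HC] := @mix_powR_le a B a0.
pose K := 2 * beta * B * (1 + N%:R * (1 + B)).
have K0 : 0 <= K.
  rewrite !mulr_ge0// ?(ltW beta_gt0)//.
  by rewrite addr_ge0// mulr_ge0// addr_ge0.
exists (B * C + (`|a - 1| + 1) * B * K * C).
  apply: addr_ge0; first exact: mulr_ge0.
  by do 3 (apply: mulr_ge0 => //); exact: addr_ge0.
move=> r z v x rB zB vB.
have f0 := mix_gt0 z x.
have s0 := sqnorm_ge0 x.
have g0 := gauss_ge0 (a * beta / 4) x.
have fa0 := powR_ge0 (mix p z x) a.
have {}HC := HC z x zB.
have fr : `|mix r z x| <= B * mix p z x by exact: norm_mix_le.
have dr : `|dmix r z v x| <= B * (K * (1 + sqnorm x)) * mix p z x.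
  exact: norm_dmix_le.
have dp : `|dmix p z v x| <= K * (1 + sqnorm x) * mix p z x.
  rewrite -[K * _]mul1r; apply: norm_dmix_le => // i.
  by rewrite mul1r ger0_norm.
split.
  rewrite /pmix normrM (ger0_norm (powR_ge0 _ _)).
  rewrite (@le_trans _ _ (B * mix p z x `^ a))//.
    by rewrite -(powR_mul1 a f0) mulrCA ler_wpM2l ?powR_ge0.
  rewrite (@le_trans _ _ (B * (C * gauss (a * beta / 4) x)))//.
    by rewrite ler_wpM2l// (le_trans _ HC)// ler_peMr// lerDl.
  rewrite (mulrDl (B * C)) (mulrA B) lerDl; apply: mulr_ge0 => //.
  by do 3 (apply: mulr_ge0 => //); exact: addr_ge0.
have E0 : 0 <= (`|a - 1| + 1) * B * K.
  by do 2 (apply: mulr_ge0 => //); exact: addr_ge0.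
rewrite /dpmix (le_trans (ler_normD _ _))//.
rewrite (mulrDl (B * C)) ler_wpDl//; first by do 2 apply: mulr_ge0 => //.
rewrite !normrM !(ger0_norm (powR_ge0 _ _)).
rewrite (@le_trans _ _ ((`|a - 1| + 1) * B * K * (mix p z x `^ a * (1 + sqnorm x))))//; last first.
  by rewrite -[X in _ <= X]mulrA ler_wpM2l.
rewrite [X in _ <= X](_ : _ = `|a - 1| * mix p z x `^ (a - 2) *
     (K * (1 + sqnorm x) * mix p z x) * (B * mix p z x) +
     mix p z x `^ (a - 1) * (B * (K * (1 + sqnorm x)) * mix p z x)); last first.
  have := powR_mul2 a f0; have := powR_mul1 a f0.
  move: (_ `^ (a - 1)) (_ `^ (a - 2)) (_ `^ a) => A1 A2 A.
  move=> E1 E2.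
  transitivity (`|a - 1| * B * K * (1 + sqnorm x) * A + B * K * (1 + sqnorm x) * A).
    by ring.
  by rewrite -{1}E2 -E1; ring.
apply: lerD; last by rewrite ler_wpM2l// powR_ge0.
by rewrite ler_pM ?mulr_ge0 ?powR_ge0// ler_pM ?mulr_ge0 ?powR_ge0.
Qed.

Lemma measurable_mix r z : measurable_fun setT (mix r z).
Proof.
apply: measurable_sum => i; apply: measurable_funM => //.
have -> : (fun x => gauss beta (x - z i)) =
  gauss beta \o (fun x => (- z i) + 1 *: x).
  by apply/funext => x /=; rewrite scale1r addrC.
apply: measurableT_comp; first exact: measurable_gauss.
exact: measurable_rV_affine.
Qed.

Lemma measurable_dmix r z v : measurable_fun setT (dmix r z v).
Proof.
apply: measurable_sum => i; apply: measurable_funM.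
  apply: measurable_funM => //.
  have -> : (fun x => gauss beta (x - z i)) =
    gauss beta \o (fun x => (- z i) + 1 *: x).
    by apply/funext => x /=; rewrite scale1r addrC.
  apply: measurableT_comp; first exact: measurable_gauss.
  exact: measurable_rV_affine.
apply: measurable_funM => //; apply: measurable_sum => k.
apply: measurable_funM => //.
under eq_fun do rewrite !mxE.
by apply: measurable_funB => //; exact: measurable_rV_coord.
Qed.

Lemma measurable_dpmix a r z v : measurable_fun setT (dpmix a p r z v).
Proof.
have mp b : measurable_fun setT (fun x => mix p z x `^ b).
  by apply: (measurableT_comp (measurable_powR b)); exact: measurable_mix.
apply: measurable_funD; apply: measurable_funM => //.
- apply: measurable_funM; last exact: measurable_dmix.
  exact: measurable_funM.
- exact: measurable_mix.
- exact: measurable_dmix.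
Qed.

Lemma measurable_pmix a r z : measurable_fun setT (pmix a p r z).
Proof.
apply: measurable_funM; last exact: measurable_mix.
apply: (measurableT_comp (measurable_powR (a - 1))); exact: measurable_mix.
Qed.

Lemma integrable_pmix (a B : R) r z : 0 < a -> (forall i, `|r i| <= B * p i) ->
  (forall i k, `|z i ord0 k| <= B) ->
  (lebesgue_rV R N).-integrable setT (EFin \o pmix a p r z).
Proof.
move=> a0 rB zB.
have B0 : 0 <= Num.max B 0 by rewrite le_max lexx orbT.
have BB : B <= Num.max B 0 by rewrite le_max lexx.
have [C C0 HC] := pmix_bound a0 B0.
apply: (@le_integrable _ _ _ _ _ _ _ (fun x => C%:E * (gauss (a * beta / 4) x)%:E)%E) => //.
- by apply/measurable_EFinP; exact: measurable_pmix.
- move=> x _ /=; rewrite lee_fin [leRHS]ger0_norm ?mulr_ge0 ?gauss_ge0//.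
  have := HC r z (fun _ => 0) x.
  case=> // [i|i k|i k]; last by rewrite mxE normr0.
  + by rewrite (le_trans (rB i))// ler_wpM2r.
  + by rewrite (le_trans (zB i k)).
- apply: integrableZl => //; apply: integrable_gauss.
  by rewrite divr_gt0// mulr_gt0.
Qed.

Lemma is_derive_pmix a r (z : R -> I -> 'rV[R]_N) v (t : R) x :
  (forall i k, is_derive t 1 (fun t => z t i ord0 k) (v i ord0 k)) ->
  is_derive t 1 (fun t => pmix a p r (z t) x) (dpmix a p r (z t) v x).
Proof.
move=> zv.
have Hr := is_derive_mix r x zv; have Hp := is_derive_mix p x zv.
have Hpow : is_derive t 1 ((fun f => f `^ (a - 1)) \o (fun t => mix p (z t) x))
    ((a - 1) * mix p (z t) x `^ (a - 1 - 1) * dmix p (z t) v x).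
  have := @is_derive1_powR R (a - 1) _ (mix_gt0 (z t) x) => H.
  exact: is_derive1_comp.
have := @is_deriveM _ _ _ _ _ _ _ _ Hpow Hr => H.
rewrite /pmix; apply: is_derive_eq.
rewrite /dpmix /GRing.scale/=.
have -> : a - 1 - 1 = a - 2 by ring.
ring.
Qed.

(** The integral of pmix is differentiated under the integral sign. *)
Lemma is_derive_int_pmix (a B u w : R) r (z v : R -> I -> 'rV[R]_N) (t : R) :
  0 < a -> 0 <= B -> t \in `]u, w[ -> (forall i, `|r i| <= B * p i) ->
  (forall (s : R) i k, s \in `]u, w[ -> `|z s i ord0 k| <= B) ->
  (forall (s : R) i k, s \in `]u, w[ -> `|v s i ord0 k| <= B) ->
  (forall (s : R) i k, is_derive s 1 (fun t => z t i ord0 k) (v s i ord0 k)) ->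
  is_derive t 1 (fun t => \int[lebesgue_rV R N]_x pmix a p r (z t) x)
    (\int[lebesgue_rV R N]_x dpmix a p r (z t) (v t) x) /\
  (lebesgue_rV R N).-integrable setT (EFin \o dpmix a p r (z t) (v t)).
Proof.
move=> a0 B0 tuw rB zB vB zv.
have [C C0 HC] := pmix_bound a0 B0.
pose G x := C * gauss (a * beta / 4) x.
have D (s : R) x : is_derive s 1 (fun t => pmix a p r (z t) x) (dpmix a p r (z s) (v s) x).
  by apply: is_derive_pmix.
have d1 (s : R) x : partial1of2 (fun t => pmix a p r (z t)) s x = dpmix a p r (z s) (v s) x.
  by rewrite partial1of2E; have := D s x => ?; rewrite derive_val.
have intf (s : R) : `]u, w[%classic s ->
    (lebesgue_rV R N).-integrable setT (EFin \o pmix a p r (z s)).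
  by move=> suw; apply: (integrable_pmix (B := B)) => // i k; exact: zB.
have der (s : R) x : `]u, w[%classic s -> setT x -> derivable (fun t => pmix a p r (z t) x) s 1.
  by move=> _ _; have := D s x => ?; exact: ex_derive.
have G0 x : 0 <= G x by rewrite mulr_ge0// gauss_ge0.
have intG : (lebesgue_rV R N).-integrable setT (EFin \o G).
  rewrite /G /comp; under eq_fun do rewrite EFinM.
  apply: integrableZl => //; apply: integrable_gauss.
  by rewrite divr_gt0// mulr_gt0.
have Gub (s : R) x : `]u, w[%classic s -> setT x ->
    `|partial1of2 (fun t => pmix a p r (z t)) s x| <= G x.
  move=> suw _; rewrite d1.
  have [//|i k|i k|] := HC r (z s) (v s) x; [exact: zB|exact: vB|by []].
split.
  apply: DeriveDef.
    exact: (derivable_under_integral measurableT tuw intf der G0 intG Gub).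
  rewrite -derive1E.
  rewrite (differentiation_under_integral measurableT tuw intf der G0 intG Gub).
  by apply: eq_Rintegral => x _; rewrite d1.
apply: (@le_integrable _ _ _ _ _ _ _ (EFin \o G)) => //.
  by apply/measurable_EFinP; exact: measurable_dpmix.
move=> x _ /=; rewrite lee_fin [X in _ <= X]ger0_norm// -d1.
exact: Gub.
Qed.

(** A common velocity -e_k of all the centres amounts to a partial derivative in
x_k, so this lemma says that the integral of a partial derivative is zero.  It
holds because the integral of pmix is invariant under translations. *)
Lemma integral_dpmix_shift (a B : R) r z (k : 'I_N) :
  0 < a -> 0 <= B -> (forall i, `|r i| <= B * p i) ->
  (forall i k, `|z i ord0 k| <= B) ->
  \int[lebesgue_rV R N]_x dpmix a p r z (fun _ => - delta_mx ord0 k) x = 0 /\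
  (lebesgue_rV R N).-integrable setT
    (EFin \o dpmix a p r z (fun _ => - delta_mx ord0 k)).
Proof.
move=> a0 B0 rB zB.
pose e : 'rV[R]_N := delta_mx ord0 k.
pose zz (h : R) i := z i - h *: e.
have BB : B <= B + 1 by rewrite lerDl.
have e1 l : `|e ord0 l| <= 1.
  by rewrite mxE eqxx/=; case: (l == k); rewrite ?normr1 ?normr0.
have zz0 : zz 0 = z by apply/funext => i; rewrite /zz scale0r subr0.
have mixE (h : R) q x : mix q (zz h) x = mix q z (x + h *: e).
  by apply: eq_bigr => i _; rewrite /zz opprB addrA addrAC.
have t0 : (0 : R) \in `](-1), 1[ by rewrite in_itv/= ltrN10 ltr01.
have B1 : 0 <= B + 1 by rewrite addr_ge0.
have [||||D iD] := @is_derive_int_pmix a (B + 1) (-1) 1 r zz (fun _ _ => - e) 0 a0 B1 t0.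
- by move=> i; rewrite (le_trans (rB i))// ler_wpM2r.
- move=> s i l; rewrite in_itv/= => /andP[s1 s2]; rewrite !mxE.
  rewrite (le_trans (ler_normB _ _))// lerD// normrM.
  have h1 : `|s| <= 1 by rewrite ler_norml (ltW s1) (ltW s2).
  by have := e1 l; rewrite mxE => h2; rewrite -[X in _ <= X]mulr1 ler_pM.
- move=> s i l _; rewrite mxE normrN (le_trans (e1 l))//.
  by rewrite lerDr.
- move=> s i l.
  have -> : (fun t => zz t i ord0 l) = (fun t => z i ord0 l - e ord0 l * t).
    by apply/funext => t; rewrite 3!mxE mulrC.
  apply: is_derive_eq; rewrite [RHS]mxE /GRing.scale/= mulr1 add0r.
  by rewrite mul1r.
rewrite zz0 in D iD; split => //.
have H0 : (fun t => \int[lebesgue_rV R N]_x pmix a p r (zz t) x) =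
    cst (\int[lebesgue_rV R N]_x pmix a p r z x).
  apply/funext => h; apply: (congr1 fine).
  have mEp : measurable_fun setT (EFin \o pmix a p r z).
    by apply/measurable_EFinP; exact: measurable_pmix.
  apply: etrans (esym (lebesgue_rV_shift (h *: e) mEp)).
  by apply: eq_integral => x _; rewrite /pmix !mixE.
rewrite -(@derive_val _ _ _ _ _ _ _ D) H0.
exact: derive_cst.
Qed.

Lemma dotv_delta (a : 'rV[R]_N) k : dotv a (- delta_mx ord0 k) = - a ord0 k.
Proof.
rewrite /dotv (bigD1 k)//= big1 ?addr0.
  by rewrite !mxE !eqxx mulrN mulr1.
by move=> l /negbTE lk; rewrite !mxE lk andbF oppr0 mulr0.
Qed.

(** The left-hand side is d/dt f^a + div (f^(a-1) w).  Indeed d/dt f = - div w, so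
that it equals (a - 1) f^(a-2) (<grad f, w> - f div w), and the double sum appears
by symmetrizing <grad f, w> - f div w in the two indices. *)
Lemma dpmix_div (a : R) z v x :
  dpmix a p p z v x +
    \sum_k dpmix a p (fun i => p i * v i ord0 k) z (fun _ => - delta_mx ord0 k) x =
  - (a - 1) * mix p z x `^ (a - 2) * beta *
    \sum_i \sum_j (p i * gauss beta (x - z i)) * (p j * gauss beta (x - z j)) *
      dotv (z i - z j) (v i - v j).
Proof.
pose q i := p i * gauss beta (x - z i).
pose SA := \sum_i \sum_j q i * q j * dotv (x - z i) (v j).
pose SB := \sum_i \sum_j q i * q j * dotv (x - z j) (v j).
have -> : \sum_i \sum_j (p i * gauss beta (x - z i)) * (p j * gauss beta (x - z j)) *
      dotv (z i - z j) (v i - v j) = (SA - SB) *+ 2.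
  pose F i j := q i * q j * dotv (x - z i) (v j) - q i * q j * dotv (x - z j) (v j).
  have -> : SA - SB = \sum_i \sum_j F i j.
    rewrite /SA /SB -sumrB; apply: eq_bigr => i _.
    by rewrite -sumrB.
  rewrite mulr2n [X in _ + X]exchange_big/= -big_split/=; apply: eq_bigr => i _.
  rewrite -big_split/=; apply: eq_bigr => j _.
  rewrite /F -!mulrBr (mulrC (q j)) -mulrDr -/(q i) -/(q j).
  congr (_ * _); rewrite /dotv -!sumrB -big_split/=; apply: eq_bigr => k _.
  by rewrite !mxE; ring.
have Sd : dmix p z v x * mix p z x = 2 * beta * SB.
  rewrite mulrC /mix mulr_suml /SB mulr_sumr; apply: eq_bigr => i _.
  rewrite /dmix !mulr_sumr; apply: eq_bigr => j _; rewrite /q; ring.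
have Sg : \sum_k dmix p z (fun _ => - delta_mx ord0 k) x * mix (fun i => p i * v i ord0 k) z x =
    - (2 * beta * SA).
  rewrite /SA !mulr_sumr -sumrN.
  transitivity (\sum_k \sum_i \sum_j
      - (2 * beta * (q i * q j * ((x - z i) ord0 k * v j ord0 k)))).
    apply: eq_bigr => k _; rewrite /dmix mulr_suml; apply: eq_bigr => i _.
    rewrite /mix mulr_sumr; apply: eq_bigr => j _.
    by rewrite dotv_delta /q; ring.
  rewrite exchange_big/=; apply: eq_bigr => i _.
  rewrite exchange_big/= mulr_sumr -sumrN; apply: eq_bigr => j _.
  by rewrite /dotv !mulr_sumr -sumrN.
have Se : \sum_k dmix (fun i => p i * v i ord0 k) z (fun _ => - delta_mx ord0 k) x =
    - dmix p z v x.
  rewrite /dmix exchange_big/= -sumrN; apply: eq_bigr => i _.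
  rewrite /dotv !mulr_sumr -sumrN; apply: eq_bigr => k _.
  by rewrite -/(dotv _ _) dotv_delta; ring.
have f0 := mix_gt0 z x.
have E : mix p z x `^ (a - 1) = mix p z x `^ (a - 2) * mix p z x.
  by rewrite -(powR_mul1 (a - 1) f0); congr (_ `^ _ * _); ring.
rewrite /dpmix big_split/= -mulr_sumr Se.
under eq_bigr do rewrite -mulrA.
rewrite -mulr_sumr Sg E -[(a - 1) * _ * _ * _]mulrA Sd mulr2n; ring.
Qed.

Lemma pmixE a z x : pmix a p p z x = mix p z x `^ a.
Proof. by rewrite /pmix powR_mul1// mix_gt0. Qed.

(** If the mutual distances of the centres do not increase, the integral of f^a is
monotone in time, nondecreasing for a >= 1 and nonincreasing for a <= 1. *)
Lemma contraction_path (a B : R) (z v : R -> I -> 'rV[R]_N) (t0 t1 : R) :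
  0 < a -> 1 <= B ->
  (forall s i k, `|z s i ord0 k| <= B) -> (forall s i k, `|v s i ord0 k| <= B) ->
  (forall (s : R) i k, is_derive s 1 (fun t => z t i ord0 k) (v s i ord0 k)) ->
  t0 <= t1 ->
  (forall s i j, s \in `]t0, t1[ -> dotv (z s i - z s j) (v s i - v s j) <= 0) ->
  let Phi t := \int[lebesgue_rV R N]_x (mix p (z t) x `^ a) in
  (1 <= a -> Phi t0 <= Phi t1) /\ (a <= 1 -> Phi t1 <= Phi t0).
Proof.
move=> a0 B1 zB vB zv t01 zvle Phi.
have B0 : 0 <= B by exact: le_trans B1.
have PhiE : Phi = fun t => \int[lebesgue_rV R N]_x pmix a p p (z t) x.
  by apply/funext => t; apply: eq_Rintegral => x _; rewrite pmixE.
have pB i : `|p i| <= B * p i by rewrite ger0_norm// ler_peMl.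
have vpB s k i : `|p i * v s i ord0 k| <= B * p i.
  by rewrite normrM (ger0_norm (p_ge0 i)) mulrC ler_wpM2r.
have D (s : R) : is_derive s 1 Phi (\int[lebesgue_rV R N]_x dpmix a p p (z s) (v s) x) /\
    (lebesgue_rV R N).-integrable setT (EFin \o dpmix a p p (z s) (v s)).
  rewrite PhiE; apply: (@is_derive_int_pmix a B (s - 1) (s + 1)) => //.
  by rewrite in_itv/= ltrBlDr ltrDl ltr01.
pose S s x := \sum_i \sum_j (p i * gauss beta (x - z s i)) * (p j * gauss beta (x - z s j)) *
      dotv (z s i - z s j) (v s i - v s j).
have S_le0 s x : s \in `]t0, t1[ -> S s x <= 0.
  move=> st; apply: sumr_le0 => i _; apply: sumr_le0 => j _.
  rewrite mulr_ge0_le0 ?zvle// !mulr_ge0// ?gauss_ge0//.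
have dE s : \int[lebesgue_rV R N]_x dpmix a p p (z s) (v s) x =
    \int[lebesgue_rV R N]_x (- (a - 1) * mix p (z s) x `^ (a - 2) * beta * S s x).
  pose Dk k := dpmix a p (fun i => p i * v s i ord0 k) (z s) (fun _ => - delta_mx ord0 k).
  have Dk0 k := @integral_dpmix_shift a B _ _ k a0 B0 (vpB s k) (zB s).
  have H (l : seq 'I_N) : \int[lebesgue_rV R N]_x (\sum_(k <- l) Dk k x) = 0 /\
      (lebesgue_rV R N).-integrable setT (EFin \o (fun x => \sum_(k <- l) Dk k x)).
    elim: l => [|k l [IH1 IH2]].
      split.
        by under eq_Rintegral do rewrite big_nil; rewrite /Rintegral integral0.
      rewrite (_ : _ \o _ = cst 0%E); first exact: integrable0.
      by apply/funext => x /=; rewrite big_nil.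
    have [E1 E2] := Dk0 k.
    split.
      under eq_Rintegral do rewrite big_cons.
      by rewrite RintegralD// E1 IH1 addr0.
    rewrite (_ : _ \o _ = (EFin \o Dk k) \+ (EFin \o (fun x => (\sum_(k <- l) Dk k x)%R)))%E.
      exact: integrableD.
    by apply/funext => x /=; rewrite big_cons EFinD.
  have [H1 H2] := H (index_enum 'I_N).
  transitivity (\int[lebesgue_rV R N]_x (dpmix a p p (z s) (v s) x + \sum_k Dk k x)).
    by rewrite RintegralD//; [rewrite H1 addr0|have [] := D s].
  by apply: eq_Rintegral => x _; rewrite dpmix_div.
have dPhi (s : R) : derivable Phi s 1 by have [? _] := D s; exact: ex_derive.
have dPhiE (s : R) : derive1 Phi s = \int[lebesgue_rV R N]_x
    (- (a - 1) * mix p (z s) x `^ (a - 2) * beta * S s x).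
  by rewrite derive1E; have [? _] := D s; rewrite derive_val.
have cPhi : {within `[t0, t1], continuous Phi}.
  by apply: derivable_within_continuous => s _.
split=> a1.
- apply: (@ger0_derive1_ndecr _ _ t0 t1) => // s st; rewrite dPhiE.
  apply: Rintegral_ge0 => x _; rewrite !mulNr oppr_ge0.
  apply: mulr_ge0_le0; last exact: S_le0.
  by rewrite !mulr_ge0 ?powR_ge0 ?subr_ge0// ltW.
- apply: (@ler0_derive1_nincr _ _ t0 t1) => // s st; rewrite dPhiE.
  apply: Rintegral_le0 => x.
  apply: mulr_ge0_le0; last exact: S_le0.
  by rewrite !mulr_ge0 ?powR_ge0 ?opprB ?subr_ge0// ltW.
Qed.

End gaussian_mixtures.

(** * Contractions of finitely many points *)
Section finite_contraction.
Variables (R : realType) (I : finType) (n : nat) (beta : R).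
Hypothesis beta_gt0 : 0 < beta.
Variable p : I -> R.
Hypothesis p_ge0 : forall i, 0 <= p i.
Hypothesis p_gt0 : exists i, 0 < p i.

Lemma sqnorm_row_mx m k (u : 'rV[R]_m) (v : 'rV[R]_k) :
  sqnorm (row_mx u v) = sqnorm u + sqnorm v.
Proof.
rewrite /sqnorm big_split_ord/=; congr (_ + _); apply: eq_bigr => i _.
  by rewrite row_mxEl.
by rewrite row_mxEr.
Qed.

Lemma dotv_row_mx m k (u u' : 'rV[R]_m) (v v' : 'rV[R]_k) :
  dotv (row_mx u v) (row_mx u' v') = dotv u u' + dotv v v'.
Proof.
rewrite /dotv big_split_ord/=; congr (_ + _); apply: eq_bigr => i _.
  by rewrite !row_mxEl.
by rewrite !row_mxEr.
Qed.

Lemma dotvZ m (c d : R) (u v : 'rV[R]_m) : dotv (c *: u) (d *: v) = c * d * dotv u v.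
Proof. by rewrite /dotv mulr_sumr; apply: eq_bigr => i _; rewrite !mxE; ring. Qed.

Lemma dotv_sqnorm m (u : 'rV[R]_m) : dotv u u = sqnorm u.
Proof. by apply: eq_bigr => i _; rewrite -expr2. Qed.

Lemma gaussD m k (u : 'rV[R]_(m + k)) (v : 'rV[R]_m) (w : 'rV[R]_k) :
  gauss beta (u - row_mx v w) = gauss beta (lsubmx u - v) * gauss beta (rsubmx u - w).
Proof.
rewrite -[u in LHS]hsubmxK opp_row_mx add_row_mx /gauss sqnorm_row_mx -expRD.
by rewrite mulrDr opprD.
Qed.

Lemma measurable_mix_powR m (u : I -> 'rV[R]_m) (a : R) :
  measurable_fun setT (fun x => (mix beta p u x `^ a)%:E).
Proof.
apply/measurable_EFinP; apply: (measurableT_comp (measurable_powR a)).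
exact: measurable_mix.
Qed.

Lemma mix_ge0 m (u : I -> 'rV[R]_m) x : 0 <= mix beta p u x.
Proof. by apply: sumr_ge0 => i _; rewrite mulr_ge0// gauss_ge0. Qed.

Lemma integral_mix_row0 m k (a : R) (u : I -> 'rV[R]_m) :
  (\int[lebesgue_rV R (m + k)]_x (mix beta p (fun i => row_mx (u i) (0 : 'rV[R]_k)) x `^ a)%:E =
   (\int[lebesgue_rV R m]_x (mix beta p u x `^ a)%:E) *
   \int[lebesgue_rV R k]_x (gauss (a * beta) x)%:E)%E.
Proof.
rewrite -lebesgue_rV_split; first last.
- by move=> x; rewrite lee_fin gauss_ge0.
- by move=> x; rewrite lee_fin powR_ge0.
- by apply/measurable_EFinP; exact: measurable_gauss.
- exact: measurable_mix_powR.
apply: eq_integral => x _; rewrite -EFinM -gauss_powR -powRM ?gauss_ge0//.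
  by rewrite /mix mulr_suml; congr (_ `^ a)%:E; apply: eq_bigr => i _;
    rewrite gaussD subr0 mulrA.
exact: mix_ge0.
Qed.

Lemma integral_mix_0row m k (a : R) (u : I -> 'rV[R]_k) :
  (\int[lebesgue_rV R (m + k)]_x (mix beta p (fun i => row_mx (0 : 'rV[R]_m) (u i)) x `^ a)%:E =
   (\int[lebesgue_rV R m]_x (gauss (a * beta) x)%:E) *
   \int[lebesgue_rV R k]_x (mix beta p u x `^ a)%:E)%E.
Proof.
rewrite -lebesgue_rV_split; first last.
- by move=> x; rewrite lee_fin powR_ge0.
- by move=> x; rewrite lee_fin gauss_ge0.
- exact: measurable_mix_powR.
- by apply/measurable_EFinP; exact: measurable_gauss.
apply: eq_integral => x _; rewrite -EFinM -gauss_powR -powRM ?gauss_ge0//.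
  by rewrite /mix mulr_sumr; congr (_ `^ a)%:E; apply: eq_bigr => i _;
    rewrite gaussD subr0 mulrCA.
exact: mix_ge0.
Qed.

(** The points x_i are joined to the points y_i in R^n x R^n, along
t |-> (cos t x_i, sin t y_i); along this path all the distances decrease. *)
Lemma finite_contraction (a : R) (x y : I -> 'rV[R]_n) : 0 < a ->
  (forall i j, sqnorm (y i - y j) <= sqnorm (x i - x j)) ->
  ((1 <= a)%R -> \int[lebesgue_rV R n]_u (mix beta p x u `^ a)%:E <=
             \int[lebesgue_rV R n]_u (mix beta p y u `^ a)%:E)%E /\
  ((a <= 1)%R -> \int[lebesgue_rV R n]_u (mix beta p y u `^ a)%:E <=
             \int[lebesgue_rV R n]_u (mix beta p x u `^ a)%:E)%E.
Proof.
move=> a0 yx.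
pose z (t : R) i := row_mx (cos t *: x i) (sin t *: y i).
pose v (t : R) i := row_mx (- sin t *: x i) (cos t *: y i).
pose B := 1 + \sum_i \sum_k (`|x i ord0 k| + `|y i ord0 k|).
have sum_ge0 : 0 <= \sum_i \sum_k (`|x i ord0 k| + `|y i ord0 k|).
  by apply: sumr_ge0 => i _; apply: sumr_ge0 => k _; rewrite addr_ge0.
have B1 : 1 <= B by rewrite lerDl.
have xyB i k : `|x i ord0 k| + `|y i ord0 k| <= B.
  rewrite /B (bigD1 i)//= (bigD1 k)//=.
  set s1 := (X in 1 + (_ + X + _)); set s2 := (X in 1 + (_ + X)).
  have s10 : 0 <= s1 by apply: sumr_ge0 => l _; rewrite addr_ge0.
  have s20 : 0 <= s2.
    by apply: sumr_ge0 => l _; apply: sumr_ge0 => m _; rewrite addr_ge0.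
  lra.
have xB i k : `|x i ord0 k| <= B by rewrite (le_trans _ (xyB i k))// lerDl.
have yB i k : `|y i ord0 k| <= B by rewrite (le_trans _ (xyB i k))// lerDr.
have cB (c b : R) : `|c| <= 1 -> `|b| <= B -> `|c * b| <= B.
  by move=> c1 bB; rewrite normrM -[X in _ <= X]mul1r ler_pM.
have cos1 (t : R) : `|cos t| <= 1 by rewrite ler_norml cos_geN1 cos_le1.
have sin1 (t : R) : `|sin t| <= 1 by rewrite ler_norml sin_geN1 sin_le1.
have zB t i k : `|z t i ord0 k| <= B.
  by rewrite /z mxE; case: (fintype.split k) => l; rewrite mxE cB.
have vB t i k : `|v t i ord0 k| <= B.
  by rewrite /v mxE; case: (fintype.split k) => l; rewrite mxE cB// normrN.
have zv (s : R) i k : is_derive s 1 (fun t => z t i ord0 k) (v s i ord0 k).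
  rewrite /z /v; under eq_fun do rewrite mxE; rewrite mxE.
  case: (fintype.split k) => l; under eq_fun do rewrite mxE mulrC; rewrite mxE mulrC;
  exact: is_deriveZ.
(* t1 is pi / 2, of which only these four properties matter. *)
have [t1 [pi0 ct1 st1 cs_ge0]] : exists t1 : R, [/\ 0 <= t1, cos t1 = 0, sin t1 = 1 &
    forall s, 0 < s -> s < t1 -> 0 <= cos s /\ 0 <= sin s].
  exists (pi / 2); rewrite cos_pihalf sin_pihalf; split => // [|s s0 s1].
    by rewrite divr_ge0// pi_ge0.
  split.
    by apply: cos_ge0_pihalf; rewrite (ltW s1) (le_trans _ (ltW s0))// oppr_le0 divr_ge0// pi_ge0.
  apply: sin_ge0_pi; rewrite (ltW s0) (le_trans (ltW s1))//.
  by rewrite ler_pdivrMr// ler_peMr ?pi_ge0// ler1n.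
have zvle (s : R) i j : s \in `]0, t1[ -> dotv (z s i - z s j) (v s i - v s j) <= 0.
  rewrite in_itv/= => /andP[s0 s1].
  rewrite /z /v !opp_row_mx !add_row_mx -!scalerBr dotv_row_mx !dotvZ !dotv_sqnorm.
  have [c0 d0] := cs_ge0 s s0 s1.
  have := yx i j; have := mulr_ge0 c0 d0.
  move: (cos s) (sin s) (sqnorm _) (sqnorm _) => c d A1 A2; nra.
have [H1 H2] := contraction_path beta_gt0 p_ge0 p_gt0 a0 B1 zB vB zv pi0 zvle.
have fin t : (\int[lebesgue_rV R (n + n)]_x (mix beta p (z t) x `^ a)%:E)%E \is a fin_num.
  have /(integrable_fin_num measurableT) : (lebesgue_rV R (n + n)).-integrable setT
      (EFin \o pmix beta a p p (z t)).
    apply: (@integrable_pmix _ _ _ _ beta_gt0 _ p_ge0 p_gt0 a B) => // i.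
    by rewrite ger0_norm// ler_peMl.
  by congr (_ \is a fin_num); apply: eq_integral => u _; rewrite /= pmixE.
have [c c0 Ec] := @gauss_integral R n (a * beta) (mulr_gt0 a0 beta_gt0).
have z0 : z 0 = fun i => row_mx (x i) 0.
  by apply/funext => i; rewrite /z cos0 sin0 scale1r scale0r.
have z1 : z t1 = fun i => row_mx 0 (y i).
  by apply/funext => i; rewrite /z ct1 st1 scale1r scale0r.
have E0 : (\int[lebesgue_rV R (n + n)]_u (mix beta p (z 0) u `^ a)%:E =
    \int[lebesgue_rV R n]_u (mix beta p x u `^ a)%:E * c%:E)%E.
  by rewrite z0 (integral_mix_row0 n a x) Ec.
have E1 : (\int[lebesgue_rV R (n + n)]_u (mix beta p (z t1) u `^ a)%:E =
    \int[lebesgue_rV R n]_u (mix beta p y u `^ a)%:E * c%:E)%E.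
  rewrite z1 (integral_mix_0row n a y) muleC.
  by congr (_ * _)%E.
have le_cancel (A B' A' B'' : \bar R) : A' = (A * c%:E)%E -> B'' = (B' * c%:E)%E ->
    (A' <= B'' -> A <= B')%E.
  by move=> -> ->; rewrite lee_pmul2r// lte_fin.
have le_fin (A B' : \bar R) : A \is a fin_num -> B' \is a fin_num ->
    fine A <= fine B' -> (A <= B')%E.
  by move=> fA fB; rewrite -lee_fin !fineK.
split=> a1.
- have H := H1 a1; have H' := le_fin _ _ (fin 0) (fin t1) H.
  exact: (le_cancel _ _ _ _ E0 E1 H').
- have H := H2 a1; have H' := le_fin _ _ (fin t1) (fin 0) H.
  exact: (le_cancel _ _ _ _ E1 E0 H').
Qed.

End finite_contraction.

(** * Smoothing of a random vector by a Gaussian kernel *)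
Lemma measurable_rVB (R : realType) n d (T : measurableType d) (f g : T -> 'rV[R]_n) :
  measurable_fun setT f -> measurable_fun setT g ->
  measurable_fun setT (fun t => f t - g t).
Proof.
move=> /measurable_fun_rVP mf /measurable_fun_rVP mg.
apply/measurable_fun_rVP => i; rewrite /comp /rV_coord.
under eq_fun do rewrite !mxE.
by apply: measurable_funB; [exact: mf|exact: mg].
Qed.

Lemma cvg_finsum (R : realType) (I : Type) (s : seq I) (F : I -> nat -> R) (l : I -> R) :
  (forall i, F i m @[m --> \oo] --> l i) ->
  \sum_(i <- s) F i m @[m --> \oo] --> \sum_(i <- s) l i.
Proof.
move=> Fl; elim: s => [|i s IHs].
  by rewrite big_nil; under eq_fun do rewrite big_nil; exact: cvg_cst.
by rewrite big_cons; under eq_fun do rewrite big_cons; exact: cvgD.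
Qed.

Lemma cvg_powR (R : realType) (a l : R) (u : nat -> R) : 0 < a ->
  (forall m, 0 <= u m) -> u m @[m --> \oo] --> l ->
  u m `^ a @[m --> \oo] --> l `^ a.
Proof.
move=> a0 u0 ul.
have l0 : 0 <= l.
  by rewrite -(cvg_lim _ ul)//; apply: limr_ge; [exact: cvgP ul|exact: nearW].
have [{}l0|l0'] := ltrP 0 l.
  have d : derivable (fun x : R => x `^ a) l 1.
    by apply: derivable_powR; rewrite in_itv/= l0.
  have c : {for l, continuous (fun x : R => x `^ a)}.
    exact/differentiable_continuous/derivable1_diffP.
  by apply: (cvg_comp u (fun x : R => x `^ a) ul).
have l00 : l = 0 by apply/eqP; rewrite eq_le l0 l0'.
rewrite l00 in ul *; rewrite powR0 ?gt_eqF//; apply/cvgrPdist_lt => e e0.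
move/cvgrPdist_lt : ul => /(_ (e `^ a^-1)); rewrite powR_gt0// => /(_ isT).
apply: filterS => m; rewrite !sub0r !normrN !ger0_norm ?powR_ge0// => um.
rewrite -[X in _ < X](powRr1 (ltW e0)) -(mulVf (x := a)) ?gt_eqF// powRrM.
by apply: gt0_ltr_powR; rewrite ?nnegrE ?powR_ge0.
Qed.

Section smoothing.
Context d (Omega : measurableType d) (R : realType) (P : probability Omega R).
Variables (n : nat) (beta : R).
Hypothesis beta_gt0 : 0 < beta.
Implicit Types (A : set Omega) (W : Omega -> 'rV[R]_n) (u : 'rV[R]_n).

(** The function u |-> E [1_A gauss (u - W)].  For A = setT and beta = 1 / (2 s) it
is proportional to the density of W + sqrt s Z; restricting to an event A allows
to work first where W is bounded. *)
Definition smoothing A W u : R := \int[P]_w (\1_A w * gauss beta (u - W w)).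

Lemma gauss_le1 u : gauss beta u <= 1.
Proof.
by rewrite /gauss -[X in _ <= X]expR0 ler_expR oppr_le0 mulr_ge0 ?sqnorm_ge0// ltW.
Qed.

Lemma gauss_kernel_ge0 A W u w : 0 <= \1_A w * gauss beta (u - W w).
Proof. by rewrite mulr_ge0// gauss_ge0. Qed.

Lemma gauss_kernel_le1 A W u w : \1_A w * gauss beta (u - W w) <= 1.
Proof.
by rewrite -[X in _ <= X]mulr1 ler_pM ?gauss_ge0 ?gauss_le1// indicE; case: (_ \in _).
Qed.

Lemma measurable_gauss_kernel2 A W : measurable A -> measurable_fun setT W ->
  measurable_fun setT (fun uw : 'rV[R]_n * Omega =>
    \1_A uw.2 * gauss beta (uw.1 - W uw.2)).
Proof.
move=> mA mW; apply: measurable_funM.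
  by apply: (measurableT_comp (measurable_indic mA)).
apply: (measurableT_comp (@measurable_gauss _ _ _)).
apply: measurable_rVB => //.
exact: (measurableT_comp mW).
Qed.

Lemma measurable_gauss_kernel A W u : measurable A -> measurable_fun setT W ->
  measurable_fun setT (fun w => \1_A w * gauss beta (u - W w)).
Proof.
move=> mA mW.
exact: (measurableT_comp (measurable_gauss_kernel2 mA mW) (measurable_pair1 u)).
Qed.

Lemma integrable_gauss_kernel A W u : measurable A -> measurable_fun setT W ->
  P.-integrable setT (fun w => (\1_A w * gauss beta (u - W w))%:E).
Proof.
move=> mA mW.
apply: (@le_integrable _ _ _ P _ _ _ (cst 1%E)) => //.
- by apply/measurable_EFinP; exact: measurable_gauss_kernel.
- move=> w _ /=; rewrite lee_fin normr1 ger0_norm ?gauss_kernel_le1//.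
  exact: gauss_kernel_ge0.
- exact: finite_measure_integrable_cst.
Qed.

Lemma smoothingE A W u : measurable A -> measurable_fun setT W ->
  (smoothing A W u)%:E = (\int[P]_w (\1_A w * gauss beta (u - W w))%:E)%E.
Proof.
move=> mA mW; rewrite /smoothing /Rintegral fineK//.
exact: (integrable_fin_num measurableT (integrable_gauss_kernel u mA mW)).
Qed.

Lemma smoothing_ge0 A W u : 0 <= smoothing A W u.
Proof. by apply: Rintegral_ge0 => w _; exact: gauss_kernel_ge0. Qed.

Lemma measurable_smoothing A W : measurable A -> measurable_fun setT W ->
  measurable_fun setT (smoothing A W).
Proof.
move=> mA mW; apply/measurable_EFinP.
rewrite (_ : _ \o _ = fun u => \int[P]_w (\1_A w * gauss beta (u - W w))%:E)%E; last first.
  by apply/funext => u /=; rewrite smoothingE.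
apply: (@measurable_fun_fubini_tonelli_F _ _ _ _ _ P
  (fun uw : 'rV[R]_n * Omega => (\1_A uw.2 * gauss beta (uw.1 - W uw.2))%:E)).
  by apply/measurable_EFinP; exact: measurable_gauss_kernel2.
by move=> uw; rewrite lee_fin gauss_kernel_ge0.
Qed.

Lemma smoothing_le_gauss A W u (B : R) : measurable A -> measurable_fun setT W ->
  (forall w k, A w -> `|W w ord0 k| <= B) ->
  smoothing A W u <= expR (beta * (n%:R * B ^+ 2)) * gauss (beta / 2) u.
Proof.
move=> mA mW WB; rewrite -lee_fin smoothingE//.
pose c := expR (beta * (n%:R * B ^+ 2)) * gauss (beta / 2) u; rewrite -/c.
have c0 : 0 <= c by rewrite mulr_ge0 ?expR_ge0 ?gauss_ge0.
rewrite (@le_trans _ _ (\int[P]_w (cst c%:E w))%E)//; last first.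
  rewrite integral_cst// [X in (_ * X)%E](_ : _ = 1%E) ?mule1//.
  exact: (probability_setT P).
apply: ge0_le_integral => //.
- by move=> w _; rewrite lee_fin gauss_kernel_ge0.
- by apply/measurable_EFinP; exact: measurable_gauss_kernel.
- move=> w _; rewrite lee_fin indicE; case: (boolP (w \in A)) => [|_]; last by rewrite mul0r.
  by rewrite inE mul1r => Aw; apply: gauss_shift_le => // k; exact: WB.
Qed.

Lemma cvg_gauss (a : nat -> 'rV[R]_n) (b : 'rV[R]_n) u :
  (forall k, a m ord0 k @[m --> \oo] --> b ord0 k) ->
  gauss beta (u - a m) @[m --> \oo] --> gauss beta (u - b).
Proof.
move=> ab; rewrite /gauss; apply: cvg_comp; last exact: continuous_expR.
apply: cvgN; apply: cvgMl_tmp.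
apply: cvg_finsum => k.
rewrite !mxE; under eq_fun do rewrite !mxE.
rewrite expr2; under eq_fun do rewrite expr2.
by apply: cvgM; apply: cvgB => //; exact: cvg_cst.
Qed.

Lemma cvg_smoothing A (W : nat -> Omega -> 'rV[R]_n) (V : Omega -> 'rV[R]_n) u :
  measurable A -> (forall m, measurable_fun setT (W m)) -> measurable_fun setT V ->
  (forall w k, W m w ord0 k @[m --> \oo] --> V w ord0 k) ->
  smoothing A (W m) u @[m --> \oo] --> smoothing A V u.
Proof.
move=> mA mW mV WV.
have H : (\int[P]_w (\1_A w * gauss beta (u - W m w))%:E @[m --> \oo] -->
    \int[P]_w (\1_A w * gauss beta (u - V w))%:E)%E.
  have [|||||_ _ //] := @dominated_convergence _ _ _ P setT measurableT
    (fun m w => (\1_A w * gauss beta (u - W m w))%:E)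
    (fun w => (\1_A w * gauss beta (u - V w))%:E) (cst 1%E).
  - by move=> m; apply/measurable_EFinP; exact: measurable_gauss_kernel.
  - by apply/measurable_EFinP; exact: measurable_gauss_kernel.
  - apply: aeW => w _; apply: cvg_EFin; first exact: nearW.
    by apply: cvgMl_tmp; exact: cvg_gauss.
  - exact: finite_measure_integrable_cst.
  - apply: aeW => w m _; rewrite /= lee_fin ger0_norm ?gauss_kernel_le1//.
    exact: gauss_kernel_ge0.
by apply: fine_cvg; rewrite -smoothingE// in H *.
Qed.

(** On an event where the vectors W_m are uniformly bounded, their pointwise
convergence carries over to the integrals of powers of the smoothings. *)
Lemma cvg_integral_smoothing_powR (a B : R) A (W : nat -> Omega -> 'rV[R]_n)
    (V : Omega -> 'rV[R]_n) : 0 < a ->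
  measurable A -> (forall m, measurable_fun setT (W m)) -> measurable_fun setT V ->
  (forall w k, W m w ord0 k @[m --> \oo] --> V w ord0 k) ->
  (forall m w k, A w -> `|W m w ord0 k| <= B) ->
  (\int[lebesgue_rV R n]_u (smoothing A (W m) u `^ a)%:E @[m --> \oo] -->
   \int[lebesgue_rV R n]_u (smoothing A V u `^ a)%:E)%E.
Proof.
move=> a0 mA mW mV WV WB.
pose c := expR (beta * (n%:R * B ^+ 2)).
have mpow U : measurable_fun setT U ->
    measurable_fun setT (fun u => (smoothing A U u `^ a)%:E).
  move=> mU; apply/measurable_EFinP; apply: (measurableT_comp (measurable_powR a)).
  exact: measurable_smoothing.
have [|||||_ _ //] := @dominated_convergence _ _ _ (lebesgue_rV R n) setT measurableT
    (fun m u => (smoothing A (W m) u `^ a)%:E)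
    (fun u => (smoothing A V u `^ a)%:E)
    (fun u => (c `^ a)%:E * (gauss (a * (beta / 2)) u)%:E)%E.
- by move=> m; exact: mpow.
- exact: mpow.
- apply: aeW => u _; apply: cvg_EFin; first exact: nearW.
  apply: cvg_powR => // [m|]; first exact: smoothing_ge0.
  exact: cvg_smoothing.
- apply: integrableZl => //; apply: integrable_gauss.
  by rewrite mulr_gt0// divr_gt0.
- apply: aeW => u m _; rewrite /= lee_fin ger0_norm ?powR_ge0//.
  rewrite -gauss_powR -powRM ?expR_ge0 ?gauss_ge0//.
  apply: ge0_ler_powR; first exact: ltW.
  + by rewrite nnegrE smoothing_ge0.
  + by rewrite nnegrE mulr_ge0 ?expR_ge0 ?gauss_ge0.
  + by apply: smoothing_le_gauss => // w k; exact: WB.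
Qed.

End smoothing.

(** * Quantization *)
Section finite_valued.
Context d (Omega : measurableType d) (R : realType) (P : probability Omega R).
Variables (I : finType) (c : Omega -> I).
Hypothesis mc : forall i, measurable (c @^-1` [set i]).

Lemma measurable_finite_comp d' (T : measurableType d') (F : I -> T) :
  measurable_fun setT (F \o c).
Proof.
move=> _ B mB; rewrite setTI.
rewrite (_ : _ @^-1` _ = \bigcup_(i in [set i | B (F i)]) (c @^-1` [set i])).
  by apply: fin_bigcup_measurable => //; exact: finite_finset.
apply/seteqP; split => [w Bw|w [i /= Bi ci]]; first by exists (c w).
by rewrite /= ci.
Qed.

(** The smoothing of a random vector F (c w), where c takes finitely many values,
is a Gaussian mixture. *)
Lemma smoothing_finite (n : nat) (beta : R) (A : set Omega) (F : I -> 'rV[R]_n) u :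
  measurable A ->
  smoothing P beta A (F \o c) u =
  mix beta (fun i => fine (P (A `&` c @^-1` [set i]))) F u.
Proof.
move=> mA.
have mAc i : measurable (A `&` c @^-1` [set i]) by exact: measurableI.
have E w : \1_A w * gauss beta (u - (F \o c) w) =
    \sum_i gauss beta (u - F i) * \1_(A `&` c @^-1` [set i]) w.
  rewrite (bigD1 (c w))//= big1 ?addr0.
    rewrite mulrC; congr (_ * _); rewrite !indicE; congr ((nat_of_bool _)%:R).
    by apply/idP/idP; rewrite !inE => // -[].
  move=> i ic; rewrite indicE memNset ?mulr0// => -[_ /= ci].
  by rewrite ci eqxx in ic.
rewrite /smoothing /Rintegral.
under eq_integral do rewrite E -sumEFin.
rewrite ge0_integral_sum//; first last.
- by move=> i w _; rewrite lee_fin mulr_ge0 ?gauss_ge0.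
- by move=> i; apply/measurable_EFinP; apply: measurable_funM => //; exact: measurable_indic.
have I1 i : (\int[P]_w (gauss beta (u - F i) * \1_(A `&` c @^-1` [set i]) w)%:E =
    (fine (P (A `&` c @^-1` [set i])) * gauss beta (u - F i))%:E)%E.
  under eq_integral do rewrite EFinM.
  rewrite ge0_integralZl_EFin ?gauss_ge0//; last first.
    by apply/measurable_EFinP; exact: measurable_indic.
  by rewrite integral_indic// setIT muleC EFinM fineK// fin_num_measure.
under eq_bigr do rewrite I1.
by rewrite sumEFin.
Qed.

End finite_valued.

Section quantizer.
Variable R : realType.

(** The index of the cell of x in the grid of mesh 1 / (m + 1) that covers
[- (m + 1), m + 1].  It is meaningful only for |x| < m + 1; other values of x get
an arbitrary index, which is harmless since each x is eventually in the range. *)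
Definition qidx (m : nat) (x : R) : 'I_(2 * m.+1 ^ 2).+1 :=
  inord (Num.trunc ((x + m.+1%:R) * m.+1%:R)).

(** The left end of the cell of index j. *)
Definition qval (m : nat) (j : 'I_(2 * m.+1 ^ 2).+1) : R := j%:R / m.+1%:R - m.+1%:R.

Lemma qval_bound m j : `|qval (m := m) j| <= m.+1%:R.
Proof.
rewrite /qval ler_norml lerBrDr addNr divr_ge0//= lerBlDr -mulr2n.
rewrite ler_pdivrMr//.
have -> : m.+1%:R *+ 2 * m.+1%:R = (2 * m.+1 ^ 2)%N%:R :> R.
  by rewrite natrM natrX expr2 mulrA mulr_natl.
by rewrite ler_nat -ltnS ltn_ord.
Qed.

Lemma qval_qidx m (x : R) : `|x| < m.+1%:R -> `|qval (qidx m x) - x| <= m.+1%:R^-1.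
Proof.
move=> /[!ltr_norml] /andP[x0 x1].
have y0 : 0 <= (x + m.+1%:R) * m.+1%:R by rewrite mulr_ge0// -lerBlDr sub0r ltW.
have /andP[t0] := truncn_itv y0; rewrite -[(Num.trunc _).+1%:R]natr1 => t1.
rewrite /qval /qidx inordK; last first.
  rewrite ltnS -(@ler_nat R) (le_trans t0)// natrM natrX expr2 mulrA ler_pM2r//.
  by rewrite mulr_natl mulr2n lerD2r ltW.
move: t0 t1; set t := (Num.trunc _)%:R => t0 t1.
have m0 : 0 < m.+1%:R :> R by [].
rewrite (_ : t / _ - _ - x = (t - (x + m.+1%:R) * m.+1%:R) / m.+1%:R); last first.
  by field; rewrite addrC natr1.
rewrite normrM (gtr0_norm (_ : 0 < m.+1%:R^-1)) ?invr_gt0//.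
rewrite -[X in _ <= X]mul1r ler_pM2r ?invr_gt0// ler_norml.
move: (_ * _) t0 t1 => Y t0 t1.
by apply/andP; split; lra.
Qed.

Lemma measurable_qidx m j : measurable (@qidx m @^-1` [set j]).
Proof.
have mt k : measurable [set x : R | (Num.trunc ((x + m.+1%:R) * m.+1%:R) <= k)%N].
  rewrite (_ : [set x : R | _] =
    (fun x : R => (x + m.+1%:R) * m.+1%:R) @^-1` `]-oo, k.+1%:R[%classic); last first.
    by apply/seteqP; split => x /=; rewrite truncn_le_nat in_itv.
  rewrite -[X in measurable X]setTI.
  have H : measurable_fun setT (fun x : R => (x + m.+1%:R) * m.+1%:R).
    by apply: measurable_funM => //; exact: measurable_funD.
  by apply: H.
pose low (k : nat) := if k is k'.+1 then
  [set x : R | (Num.trunc ((x + m.+1%:R) * m.+1%:R) <= k')%N] else set0.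
rewrite (_ : _ @^-1` _ = \bigcup_(k in [set k | inord k = j])
   ([set x : R | (Num.trunc ((x + m.+1%:R) * m.+1%:R) <= k)%N] `\` low k)).
  apply: bigcup_measurable => k _; apply: measurableD => //.
  by case: k => [|k]; [exact: measurable0|exact: mt].
apply/seteqP; split => [x /= xj|x [k /= kj [tk ntk]]].
  exists (Num.trunc ((x + m.+1%:R) * m.+1%:R)) => //; split; first exact: leqnn.
  by case E : (Num.trunc _) => [|k] /=; [case|rewrite E ltnn].
have tk' : Num.trunc ((x + m.+1%:R) * m.+1%:R) = k.
  apply/eqP; rewrite eqn_leq tk/= leqNgt; apply/negP.
  by case: k ntk kj tk => //= k ntk _ _; rewrite ltnS => /ntk.
by rewrite /= /qidx tk'.
Qed.

End quantizer.

(** * Comparison of the integrals of powers for a contraction *)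
Lemma cvg_coord (R : realType) n (a : nat -> 'rV[R]_n) (b : 'rV[R]_n) :
  sqnorm (a m - b) @[m --> \oo] --> (0 : R) ->
  forall k, a m ord0 k @[m --> \oo] --> b ord0 k.
Proof.
move=> ab k; apply/cvgrPdist_lt => e e0.
have e20 : 0 < e ^+ 2 by rewrite exprn_gt0.
move/cvgrPdist_lt : ab => /(_ _ e20); apply: filterS => m.
rewrite sub0r normrN ger0_norm ?sqnorm_ge0// => ab.
have : (a m ord0 k - b ord0 k) ^+ 2 < e ^+ 2.
  rewrite (le_lt_trans _ ab)// /sqnorm (bigD1 k)//= !mxE lerDl.
  by apply: sumr_ge0 => l _; exact: sqr_ge0.
by rewrite -(real_normK (num_real _)) ltr_pXn2r ?nnegrE ?(ltW e0)// distrC.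
Qed.

Section comparison.
Context d (Omega : measurableType d) (R : realType) (P : probability Omega R).
Variables (n : nat) (beta : R) (T : 'rV[R]_n -> 'rV[R]_n) (X : Omega -> 'rV[R]_n).
Hypothesis beta_gt0 : 0 < beta.
Hypothesis T_lip : lipschitz1 T.
Hypothesis mX : measurable_fun setT X.

Lemma sqnorm_lip x y : sqnorm (T x - T y) <= sqnorm (x - y).
Proof. by rewrite -!norm2_sqr lerXn2r ?nnegrE ?sqrtr_ge0. Qed.

(* W m is the quantization of X at level m, coordinate by coordinate: qc is its
   index in a finite type and qpt the corresponding point. *)
Let qpt (m : nat) (i : {ffun 'I_n -> 'I_(2 * m.+1 ^ 2).+1}) : 'rV[R]_n := \row_l qval R (i l).
Let qc m (w : Omega) : {ffun 'I_n -> 'I_(2 * m.+1 ^ 2).+1} :=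
  [ffun l => qidx m (X w ord0 l)].
Let W (m : nat) (w : Omega) := qpt (qc m w).

Lemma measurable_qc m i : measurable (qc m @^-1` [set i]).
Proof.
rewrite (_ : _ @^-1` _ = \bigcap_(l in [set: 'I_n])
  ((fun w => X w ord0 l) @^-1` (@qidx R m @^-1` [set i l]))).
  apply: fin_bigcap_measurable => // l _.
  rewrite -[Y in measurable Y]setTI.
  have /measurable_fun_rVP/(_ l) H := mX.
  by apply: H => //; exact: measurable_qidx.
apply/seteqP; split => [w /= <- l _|w h] /=; first by rewrite /qc ffunE.
by apply/ffunP => l; rewrite ffunE; exact: h.
Qed.

Lemma cvg_W w k : W m w ord0 k @[m --> \oo] --> X w ord0 k.
Proof.
apply/cvgrPdist_le => e e0; near=> m.
rewrite /W /= /qpt mxE /qc ffunE distrC (le_trans (qval_qidx _))//.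
  near: m; exists (Num.trunc `|X w ord0 k|) => // m /= Hm.
  by rewrite (lt_le_trans (truncnS_gt _))// ler_nat ltnS.
by near: m; have := near_infty_natSinv_lt (PosNum e0); apply: filterS => m /= /ltW.
Unshelve. all: by end_near. Qed.

Lemma cvg_sqnorm_W w : sqnorm (W m w - X w) @[m --> \oo] --> (0 : R).
Proof.
rewrite (_ : 0 = \sum_(k < n) 0 :> R); last by rewrite big1.
apply: cvg_finsum => k.
have H : (fun m => W m w ord0 k - X w ord0 k) @ \oo --> X w ord0 k - X w ord0 k.
  by apply: (cvgB (@cvg_W w k)); exact: cvg_cst.
rewrite (_ : (0 : R) = (X w ord0 k - X w ord0 k) * (X w ord0 k - X w ord0 k));
  last by rewrite subrr mulr0.
rewrite (_ : (fun m => _) = (fun m => (W m w ord0 k - X w ord0 k) * (W m w ord0 k - X w ord0 k))).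
  exact: (cvgM H H).
by apply/funext => m; rewrite !mxE expr2.
Qed.

Lemma cvg_TW w k : T (W m w) ord0 k @[m --> \oo] --> T (X w) ord0 k.
Proof.
apply: cvg_coord; apply: (squeeze_cvgr _ (cvg_cst 0) (@cvg_sqnorm_W w)).
by apply: nearW => m; rewrite sqnorm_ge0 sqnorm_lip.
Qed.

(** T X is a limit of finitely valued functions; taking X = id, the measurability
of a Lipschitz map for the product sigma-algebra comes out as well. *)
Lemma measurable_lipschitz_comp : measurable_fun setT (T \o X).
Proof.
apply/measurable_fun_rVP => k.
apply: (@measurable_fun_cvg _ _ _ _ (fun m w => T (W m w) ord0 k)) => [m|w _].
  exact: (measurable_finite_comp (@measurable_qc m) (fun i => T (qpt i) ord0 k)).
exact: cvg_TW.
Qed.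

Let measurable_W m : measurable_fun setT (W m).
Proof. exact: (measurable_finite_comp (@measurable_qc m) (@qpt m)). Qed.

Let measurable_TW m : measurable_fun setT (fun w => T (W m w)).
Proof. exact: (measurable_finite_comp (@measurable_qc m) (T \o @qpt m)). Qed.

Lemma norm_W (K : R) m w k : `|X w ord0 k| <= K -> `|W m w ord0 k| <= K + 1.
Proof.
move=> XK; rewrite /W /qpt /qc mxE ffunE.
have [Xm|mX'] := ltP `|X w ord0 k| m.+1%:R; last first.
  by rewrite (le_trans (qval_bound _ _))// (le_trans mX')// (le_trans XK)// lerDl.
rewrite -[qval _ _](subrK (X w ord0 k)) (le_trans (ler_normD _ _))// addrC lerD//.
by rewrite (le_trans (qval_qidx Xm))// invf_le1// ler1n.
Qed.

(** A crude bound, which avoids the square root: t <= t^2 + 1. *)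
Lemma norm_lip (B : R) (x : 'rV[R]_n) k : (forall l, `|x ord0 l| <= B) ->
  `|T x ord0 k| <= n%:R * B ^+ 2 + 1 + \sum_l `|T 0 ord0 l|.
Proof.
move=> xB; rewrite -[T x ord0 k](subrK (T 0 ord0 k)) (le_trans (ler_normD _ _))//.
apply: lerD; last first.
  rewrite (bigD1 k)//= lerDl; apply: sumr_ge0 => l _; exact: normr_ge0.
have H : (T x ord0 k - T 0 ord0 k) ^+ 2 <= n%:R * B ^+ 2.
  rewrite (@le_trans _ _ (sqnorm (T x - T 0)))//.
    rewrite /sqnorm (bigD1 k)//= !mxE lerDl.
    by apply: sumr_ge0 => l _; exact: sqr_ge0.
  rewrite (le_trans (sqnorm_lip _ _))// subr0 /sqnorm.
  rewrite -[n in n%:R]card_ord mulr_natl -sumr_const ler_sum// => l _.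
  by rewrite -(real_normK (num_real _)) lerXn2r ?nnegrE ?(le_trans _ (xB l)).
move: H; rewrite -(real_normK (num_real _)).
have := normr_ge0 (T x ord0 k - T 0 ord0 k); move: (`|_ - _|) (n%:R * _) => s t.
nra.
Qed.

Let Phi A V (a : R) := (\int[lebesgue_rV R n]_u (smoothing P beta A V u `^ a)%:E)%E.

(** The comparison for quantized vectors on an event A. *)
Lemma contraction_quant m A (a : R) : measurable A -> 0 < a ->
  ((1 <= a)%R -> (Phi A (W m) a <= Phi A (fun w => T (W m w)) a)%E) /\
  ((a <= 1)%R -> (Phi A (fun w => T (W m w)) a <= Phi A (W m) a)%E).
Proof.
move=> mA a0.
pose p i := fine (P (A `&` qc m @^-1` [set i])).
have p_ge0 i : 0 <= p i by rewrite fine_ge0.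
have EW : Phi A (W m) a =
    (\int[lebesgue_rV R n]_u (mix beta p (@qpt m) u `^ a)%:E)%E.
  apply: eq_integral => u _.
  by rewrite -(smoothing_finite P (@measurable_qc m) beta (@qpt m) u mA).
have ET : Phi A (fun w => T (W m w)) a =
    (\int[lebesgue_rV R n]_u (mix beta p (T \o @qpt m) u `^ a)%:E)%E.
  apply: eq_integral => u _.
  by rewrite -(smoothing_finite P (@measurable_qc m) beta (T \o @qpt m) u mA).
rewrite EW ET.
(* If A is negligible, both smoothings vanish identically. *)
have [p_gt0|p0] := pselect (exists i, 0 < p i).
  by apply: finite_contraction => // i j; exact: sqnorm_lip.
have {}p0 i : p i = 0.
  apply/eqP; rewrite eq_le p_ge0 andbT leNgt; apply/negP => pi0.
  by apply: p0; exists i.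
have mix0 (z : {ffun 'I_n -> 'I_(2 * m.+1 ^ 2).+1} -> 'rV[R]_n) u : mix beta p z u = 0.
  by rewrite /mix big1// => i _; rewrite p0 mul0r.
have E0 (z : {ffun 'I_n -> 'I_(2 * m.+1 ^ 2).+1} -> 'rV[R]_n) :
    (\int[lebesgue_rV R n]_u (mix beta p z u `^ a)%:E =
     \int[lebesgue_rV R n]_u ((0 : R) `^ a)%:E)%E.
  by apply: eq_integral => u _; rewrite mix0.
have E1 := etrans (E0 (@qpt m)) (esym (E0 (T \o @qpt m))).
have le_of_eq (x y : \bar R) : x = y -> (x <= y)%E by move=> ->.
by split=> _; apply: le_of_eq; [exact: E1|exact: (esym E1)].
Qed.

(* The event that X is bounded by K in each coordinate. *)
Let A K := [set w | forall k, `|X w ord0 k| <= K%:R].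

Lemma measurable_A K : measurable (A K).
Proof.
rewrite (_ : A K = \bigcap_(l in [set: 'I_n])
  ((fun w => `|X w ord0 l|) @^-1` `]-oo, K%:R]%classic)).
  apply: fin_bigcap_measurable => // l _.
  rewrite -[Y in measurable Y]setTI.
  have /measurable_fun_rVP/(_ l) H := mX.
  have H2 : measurable_fun setT (fun w => `|X w ord0 l|).
    exact: (measurableT_comp (@normr_measurable _ _) H).
  by apply: H2.
apply/seteqP; split => [w /= h l _|w h l] /=; first by rewrite in_itv/=.
by have := h l I; rewrite /= in_itv/=.
Qed.

Lemma contraction_bounded K (a : R) : 0 < a ->
  ((1 <= a)%R -> (Phi (A K) X a <= Phi (A K) (T \o X) a)%E) /\
  ((a <= 1)%R -> (Phi (A K) (T \o X) a <= Phi (A K) X a)%E).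
Proof.
move=> a0.
have cX : Phi (A K) (W m) a @[m --> \oo] --> Phi (A K) X a.
  apply: (@cvg_integral_smoothing_powR _ _ _ P _ _ beta_gt0 a (K%:R + 1)) => //.
  - exact: measurable_A.
  - by move=> w k; exact: cvg_W.
  - by move=> m w k Aw; exact: norm_W.
have cT : Phi (A K) (fun w => T (W m w)) a @[m --> \oo] --> Phi (A K) (T \o X) a.
  apply: (@cvg_integral_smoothing_powR _ _ _ P _ _ beta_gt0 a
    (n%:R * (K%:R + 1) ^+ 2 + 1 + \sum_l `|T 0 ord0 l|)) => //.
  - exact: measurable_A.
  - exact: measurable_lipschitz_comp.
  - by move=> w k; exact: cvg_TW.
  - by move=> m w k Aw; apply: norm_lip => l; exact: norm_W.
split=> a1.
- apply: (lee_cvg_to cX cT); apply: nearW => m.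
  by apply: (contraction_quant m (measurable_A K) a0).1.
- apply: (lee_cvg_to cT cX); apply: nearW => m.
  by apply: (contraction_quant m (measurable_A K) a0).2.
Qed.

Lemma cvg_smoothing_A (V : Omega -> 'rV[R]_n) u : measurable_fun setT V ->
  smoothing P beta (A K) V u @[K --> \oo] --> smoothing P beta setT V u.
Proof.
move=> mV.
have H : (\int[P]_w (\1_(A K) w * gauss beta (u - V w))%:E @[K --> \oo] -->
    \int[P]_w (\1_[set: Omega] w * gauss beta (u - V w))%:E)%E.
  have [|||||_ _ //] := @dominated_convergence _ _ _ P setT measurableT
    (fun K w => (\1_(A K) w * gauss beta (u - V w))%:E)
    (fun w => (\1_[set: Omega] w * gauss beta (u - V w))%:E) (cst 1%E).
  - by move=> K; apply/measurable_EFinP; apply: measurable_gauss_kernel => //; exact: measurable_A.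
  - by apply/measurable_EFinP; exact: measurable_gauss_kernel.
  - apply: aeW => w _; apply: cvg_near_cst.
    exists (Num.trunc (\sum_k `|X w ord0 k|)).+1 => // K /= HK.
    rewrite !indicE in_setT mem_set// => k.
    rewrite (@le_trans _ _ (\sum_k `|X w ord0 k|))//.
      by rewrite (bigD1 k)//= lerDl sumr_ge0.
    by rewrite (le_trans (ltW (truncnS_gt _)))// ler_nat.
  - exact: finite_measure_integrable_cst.
  - apply: aeW => w K _; rewrite /= lee_fin ger0_norm ?gauss_kernel_le1//.
    exact: gauss_kernel_ge0.
by apply: fine_cvg; rewrite smoothingE.
Qed.

Lemma smoothing_A_le (V : Omega -> 'rV[R]_n) u K K' : measurable_fun setT V ->
  (K <= K')%N -> smoothing P beta (A K) V u <= smoothing P beta (A K') V u.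
Proof.
move=> mV KK'; rewrite -lee_fin !smoothingE//; [|exact: measurable_A|exact: measurable_A].
have mA := measurable_A.
apply: ge0_le_integral => //.
- by move=> w _; rewrite lee_fin gauss_kernel_ge0.
- by apply/measurable_EFinP; exact: measurable_gauss_kernel.
- by apply/measurable_EFinP; exact: measurable_gauss_kernel.
- move=> w _; rewrite lee_fin ler_wpM2r ?gauss_ge0// !indicE ler_nat.
  case: (boolP (w \in A K)) => //; rewrite inE => Aw.
  rewrite mem_set// => k; rewrite (le_trans (Aw k))// ler_nat; exact: KK'.
Qed.

Lemma cvg_Phi (V : Omega -> 'rV[R]_n) (a : R) : 0 < a -> measurable_fun setT V ->
  Phi (A K) V a @[K --> \oo] --> Phi setT V a.
Proof.
move=> a0 mV; have mA := measurable_A.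
have E u : limn (fun K => (smoothing P beta (A K) V u `^ a)%:E) =
    (smoothing P beta setT V u `^ a)%:E.
  apply/cvg_lim => //; apply: cvg_EFin; first exact: nearW.
  apply: cvg_powR => // [K|]; first exact: smoothing_ge0.
  exact: cvg_smoothing_A.
rewrite /Phi; under [X in _ --> X]eq_integral => u _ do rewrite -E.
apply: cvg_monotone_convergence => //.
- move=> K; apply/measurable_EFinP; apply: (measurableT_comp (measurable_powR a)).
  exact: measurable_smoothing.
- by move=> K u _; rewrite lee_fin powR_ge0.
- move=> u _ K K' KK'; rewrite lee_fin; apply: ge0_ler_powR; first exact: ltW.
  + by rewrite nnegrE smoothing_ge0.
  + by rewrite nnegrE smoothing_ge0.
  + exact: smoothing_A_le.
Qed.

(** The comparison of the integrals of powers, for every law of X: monotone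
convergence along the events A K. *)
Lemma contraction_powR (a : R) : 0 < a ->
  ((1 <= a)%R -> (Phi setT X a <= Phi setT (T \o X) a)%E) /\
  ((a <= 1)%R -> (Phi setT (T \o X) a <= Phi setT X a)%E).
Proof.
move=> a0; have cX := cvg_Phi a0 mX; have cT := cvg_Phi a0 measurable_lipschitz_comp.
split=> a1.
- apply: (lee_cvg_to cX cT); apply: nearW => K.
  by apply: (contraction_bounded K a0).1.
- apply: (lee_cvg_to cT cX); apply: nearW => K.
  by apply: (contraction_bounded K a0).2.
Qed.

End comparison.

(** * The density of the smoothed vector *)
Section density.
Context d (Omega : measurableType d) (R : realType) (P : probability Omega R).
Variable n : nat.

(** The joint law of independent vectors is the product of their laws. *)
Lemma joint_law (X Z : {RV P >-> 'rV[R]_n}) (B : set ('rV[R]_n * 'rV[R]_n)) :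
  independent_RV P X Z -> measurable B ->
  P [set w | B (X w, Z w)] =
  (\int[P]_w P (Z @^-1` [set z | B (X w, z)]))%E.
Proof.
move=> ind mB.
have mXZ : measurable_fun setT (fun w => (X w, Z w)).
  by apply: measurable_fun_pair; exact: measurable_funPT.
pose m0 : {measure set ('rV[R]_n * 'rV[R]_n) -> \bar R} :=
  pushforward P (fun w => (X w, Z w)).
have := @product_measure_unique _ _ _ _ R (distribution P X) (distribution P Z) (m0 mXZ).
move=> /(_ _ B mB) H.
transitivity ((distribution P X \x distribution P Z)%E B).
  by rewrite H.
rewrite /product_measure1 ge0_integral_distribution//.
- apply: eq_integral => w _ /=; rewrite /distribution /pushforward; congr (P _).
  apply/seteqP; split => w' /=; rewrite /xsection/= ?inE//.
- exact: measurable_fun_xsection.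
Qed.

Lemma gauss_densityE (x : 'rV[R]_n) :
  gauss_density x = (2 * pi) `^ (- (n%:R / 2)) * gauss (1 / 2) x.
Proof. by rewrite /gauss_density norm2_sqr /gauss; congr (_ * expR (- _)); field. Qed.

(** The normalising constant (2 pi s)^(-n/2) of the Gaussian of covariance s I. *)
Definition peak (s : R) : R := (2 * pi) `^ (- (n%:R / 2)) / Num.sqrt s ^+ n.

Lemma peak_gt0 s : 0 < s -> 0 < peak s.
Proof.
by move=> s0; rewrite /peak divr_gt0 ?exprn_gt0 ?sqrtr_gt0// powR_gt0// mulr_gt0// pi_gt0.
Qed.

(** The law of x + sqrt s Z for a fixed vector x. *)
Lemma standard_gaussian_shift (Z : Omega -> 'rV[R]_n) (s : R) (x : 'rV[R]_n)
    (A : set 'rV[R]_n) : 0 < s -> standard_gaussian P Z -> measurable A ->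
  (P (Z @^-1` [set z | A (x + Num.sqrt s *: z)%R]) =
   \int[lebesgue_rV R n]_u (\1_A u * (peak s * gauss (2 * s)^-1 (u - x)%R))%:E)%E.
Proof.
move=> s0 [_ _ ZE] mA.
have r0 : 0 < Num.sqrt s by rewrite sqrtr_gt0.
have mB : measurable [set z : 'rV[R]_n | A (x + Num.sqrt s *: z)].
  rewrite -[X in measurable X]setTI.
  exact: (measurable_rV_affine x (Num.sqrt s)).
have mh : measurable_fun setT
    (fun u => (\1_A u * (peak s * gauss (2 * s)^-1 (u - x)))%:E).
  apply/measurable_EFinP; apply: measurable_funM; first exact: measurable_indic.
  apply: measurable_funM => //; apply: (measurableT_comp (@measurable_gauss _ _ _)).
  exact: measurable_rVB.
have h0 u : 0 <= \1_A u * (peak s * gauss (2 * s)^-1 (u - x)).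
  apply: mulr_ge0 => //; apply: mulr_ge0; last exact: gauss_ge0.
  by apply: ltW; exact: peak_gt0.
rewrite ZE// integral_mkcond (lebesgue_rV_affine x r0); first last.
- by move=> u; rewrite lee_fin h0.
- exact: mh.
rewrite -ge0_integralZl_EFin//; first last.
- exact: (measurableT_comp mh (measurable_rV_affine x (Num.sqrt s))).
- by move=> u _; rewrite lee_fin h0.
apply: eq_integral => z _; rewrite patchE.
rewrite -EFinM gauss_densityE /peak.
have -> : gauss (2 * s)^-1 (x + Num.sqrt s *: z - x) = gauss (1 / 2) z.
  rewrite addrC addKr /gauss; congr (expR (- _)).
  rewrite /sqnorm; under eq_bigr do rewrite mxE exprMn sqr_sqrtr ?(ltW s0)//.
  by rewrite -mulr_sumr; field; rewrite gt_eqF.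
rewrite indicE.
have -> : (x + Num.sqrt s *: z \in A) = (z \in [set z | A (x + Num.sqrt s *: z)]).
  by apply/idP/idP; rewrite !inE.
case: ifPn => _; last by rewrite mul0r mulr0.
have rn : Num.sqrt s ^+ n != 0 by rewrite expf_neq0// gt_eqF.
congr EFin.
move: (_ ^+ n) rn (_ `^ _) (gauss _ _) => q q0 k g.
by rewrite mul1r mulrA (mulrC q) mulfVK.
Qed.

Lemma is_density_smoothing (Y Z : {RV P >-> 'rV[R]_n}) (s : R) : 0 < s ->
  standard_gaussian P Z -> independent_RV P Y Z ->
  is_density P (fun w => Y w + Num.sqrt s *: Z w)
    (fun u => peak s * smoothing P (2 * s)^-1 setT Y u).
Proof.
move=> s0 gZ ind.
have b0 : 0 < (2 * s)^-1 by rewrite invr_gt0 mulr_gt0.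
have mY : measurable_fun setT Y by exact: measurable_funPT.
split.
- by apply: measurable_funM => //; exact: measurable_smoothing.
- by move=> u; rewrite mulr_ge0 ?smoothing_ge0// ltW// peak_gt0.
move=> A mA.
pose B : set ('rV[R]_n * 'rV[R]_n) := [set xz | A (xz.1 + Num.sqrt s *: xz.2)].
have mB : measurable B.
  rewrite -[X in measurable X]setTI.
  have H : measurable_fun setT (fun xz : 'rV[R]_n * 'rV[R]_n => xz.1 + Num.sqrt s *: xz.2).
    apply/measurable_fun_rVP => i; rewrite /comp /rV_coord.
    under eq_fun do rewrite !mxE.
    apply: measurable_funD; last apply: measurable_funM => //.
      exact: (measurableT_comp (measurable_rV_coord i) measurable_fst).
    exact: (measurableT_comp (measurable_rV_coord i) measurable_snd).
  by apply: H.
transitivity (P [set w | B (Y w, Z w)]); first by [].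
rewrite joint_law//.
under eq_integral => w _ do rewrite (standard_gaussian_shift (Y w) s0 gZ mA).
pose h (wu : Omega * 'rV[R]_n) : \bar R :=
  (\1_A wu.2 * (peak s * gauss (2 * s)^-1 (wu.2 - Y wu.1)))%:E.
have mh : measurable_fun setT h.
  apply/measurable_EFinP; apply: measurable_funM.
    exact: (measurableT_comp (measurable_indic mA) measurable_snd).
  apply: measurable_funM => //; apply: (measurableT_comp (@measurable_gauss _ _ _)).
  by apply: measurable_rVB => //; exact: (measurableT_comp mY).
have pk := ltW (peak_gt0 s0).
have h0 wu : (0 <= h wu)%E.
  rewrite lee_fin; apply: mulr_ge0 => //; apply: mulr_ge0 => //; exact: gauss_ge0.
have := @fubini_tonelli _ _ _ _ _ P (lebesgue_rV R n) h mh h0.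
rewrite /h /= => ->.
rewrite [RHS]integral_mkcond; apply: eq_integral => u _.
rewrite patchE indicE; case: ifPn => _; last first.
  by under eq_integral do rewrite mul0r; rewrite integral0.
rewrite EFinM smoothingE// -ge0_integralZl_EFin//; first last.
- by apply/measurable_EFinP; exact: measurable_gauss_kernel.
- by move=> w _; rewrite lee_fin gauss_kernel_ge0.
by apply: eq_integral => w _; rewrite indicT !mul1r EFinM.
Qed.

End density.

(** * Order 1: the Shannon entropy *)
Section shannon.
Context d (T : measurableType d) (R : realType) (mu : {measure set T -> \bar R}).
Variable C : R.
Hypothesis C_ge1 : 1 <= C.
Implicit Types (f : T -> R) (e t : R).

(* K f dominates f ln f as soon as 0 < f <= C. *)
Let K := C * ln C.

Lemma xlnx_const_ge0 : 0 <= K.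
Proof. by rewrite mulr_ge0 ?ln_ge0// (le_trans _ C_ge1). Qed.

Lemma powR_sub1_ge t e : 0 < t -> 0 < e -> ln t <= (t `^ e - 1) / e.
Proof.
move=> t0 e0; rewrite ler_pdivlMr// lerBrDl /powR gt_eqF//.
by rewrite mulrC expR_ge1Dx.
Qed.

Lemma powR_sub1_ln_le t e : 0 < t -> 0 < e -> (t `^ e - 1) / e <= ln t * t `^ e.
Proof.
move=> t0 e0; rewrite ler_pdivrMr// mulrC mulrA.
rewrite /powR gt_eqF//; have := expR_ge1Dx (- (e * ln t)).
rewrite expRN; have := expR_gt0 (e * ln t).
move: (e * ln t) => x; move: (expR x) => E E0.
rewrite -(ler_pM2l E0) mulfV ?gt_eqF// mulrDr mulr1 mulrN => H; lra.
Qed.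

Lemma powR_sub1_le t e : 0 < t -> t <= C -> 0 < e -> e <= 1 ->
  (t `^ e - 1) / e <= K.
Proof.
move=> t0 tC e0 e1.
have [t1|t1] := lerP t 1.
  rewrite ler_pdivrMr//.
  apply: (@le_trans _ _ 0); last by apply: mulr_ge0; [exact: xlnx_const_ge0|exact: ltW].
  have p1 : 1 = 1 `^ e :> R by rewrite powR1.
  rewrite subr_le0 [X in _ <= X]p1.
  by apply: ge0_ler_powR; rewrite ?nnegrE//; exact: ltW.
rewrite (le_trans (powR_sub1_ln_le t0 e0))// /K mulrC.
have C0 : 0 <= C := le_trans ler01 C_ge1.
apply: ler_pM; first exact: powR_ge0.
- by rewrite ln_ge0//; exact: ltW.
- rewrite (@le_trans _ _ (C `^ e))//; last by rewrite ler1_powR.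
  by apply: ge0_ler_powR; rewrite ?nnegrE//; exact: ltW.
- by rewrite ler_ln ?posrE// (lt_le_trans t0).
Qed.

Lemma cvg_powR_sub1 t : 0 < t ->
  (t `^ k.+1%:R^-1 - 1) / k.+1%:R^-1 @[k --> \oo] --> ln t.
Proof.
move=> t0.
have H : ln t * t `^ k.+1%:R^-1 @[k --> \oo] --> ln t.
  have A : ln t * expR (k.+1%:R^-1 * ln t) @[k --> \oo] --> ln t * expR (0 * ln t).
    apply: cvgMl_tmp; apply: cvg_comp; last exact: continuous_expR.
    by apply: cvgMr_tmp; exact: cvg_harmonic.
  by rewrite mul0r expR0 mulr1 in A; rewrite /powR gt_eqF.
apply: (squeeze_cvgr _ (cvg_cst (ln t)) H); apply: nearW => k.
by rewrite powR_sub1_ge//= powR_sub1_ln_le.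
Qed.

(** A positive probability density bounded by C. *)
Definition bounded_density f := [/\ measurable_fun setT f,
  forall x, 0 < f x, forall x, f x <= C & (\int[mu]_x (f x)%:E = 1)%E].

(** The integral of the nonnegative function K f - f ln f.  It is K plus the Shannon
entropy, in a form that always makes sense as an extended real. *)
Definition neg_entropy_gap f := (\int[mu]_x (K * f x - f x * ln (f x))%:E)%E.

Lemma neg_entropy_gap_ge0 f x : bounded_density f -> 0 <= K * f x - f x * ln (f x).
Proof.
move=> [_ f0 fC _]; rewrite subr_ge0 (mulrC K) ler_wpM2l ?(ltW (f0 x))//.
rewrite (le_trans (powR_sub1_ge (f0 x) ltr01))//.
exact: powR_sub1_le.
Qed.

Lemma measurable_xlnx f : measurable_fun setT f ->
  measurable_fun setT (fun x => f x * ln (f x)).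
Proof.
by move=> mf; apply: measurable_funM => //; exact: (measurableT_comp (@measurable_ln _)).
Qed.

(* The same with ln f replaced by (f^e - 1) / e for e = 1 / (k + 1); its integral
   is a function of the integral of f^(1 + e) only. *)
Let diffquot_gap f k x := K * f x - f x * ((f x `^ k.+1%:R^-1 - 1) / k.+1%:R^-1).

Lemma diffquot_gap_ge0 f k x : bounded_density f -> 0 <= diffquot_gap f k x.
Proof.
move=> [_ f0 fC _]; rewrite /diffquot_gap subr_ge0 (mulrC K) ler_wpM2l ?(ltW (f0 x))//.
by apply: powR_sub1_le => //; rewrite ?invr_gt0// invf_le1// ler1n.
Qed.

Lemma measurable_diffquot_gap f k : measurable_fun setT f -> measurable_fun setT (diffquot_gap f k).
Proof.
move=> mf; apply: measurable_funB; first exact: measurable_funM.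
apply: measurable_funM => //; apply: measurable_funM => //.
apply: measurable_funB => //.
exact: (measurableT_comp (measurable_powR _) mf).
Qed.

Lemma integral_diffquot_gap f k : bounded_density f ->
  (\int[mu]_x (diffquot_gap f k x)%:E +
   k.+1%:R%:E * \int[mu]_x (f x `^ (1 + k.+1%:R^-1))%:E = (K + k.+1%:R)%:E)%E.
Proof.
move=> bf; have [mf f0 fC f1] := bf.
rewrite -ge0_integralZl_EFin//; first last.
- apply/measurable_EFinP; exact: (measurableT_comp (measurable_powR _) mf).
- by move=> x _; rewrite lee_fin powR_ge0.
rewrite -ge0_integralD//; first last.
- apply/measurable_EFinP; apply: measurable_funM => //.
  exact: (measurableT_comp (measurable_powR _) mf).
- by move=> x _; rewrite -EFinM lee_fin mulr_ge0// powR_ge0.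
- by apply/measurable_EFinP; exact: measurable_diffquot_gap.
- by move=> x _; rewrite lee_fin diffquot_gap_ge0.
rewrite -[RHS]mule1 -f1 -ge0_integralZl_EFin//; first last.
- by rewrite addr_ge0 ?xlnx_const_ge0.
- by apply/measurable_EFinP.
- by move=> x _; rewrite lee_fin (ltW (f0 x)).
apply: eq_integral => x _; rewrite -!EFinM -EFinD /diffquot_gap; congr EFin.
rewrite powRD ?(gt_eqF (f0 x)) ?implybT// powRr1 ?(ltW (f0 x))//.
by rewrite invrK; ring.
Qed.

(** The difference quotients (t^e - 1) / e tend to ln t from above as e tends to 0.
Fatou's lemma bounds the gap of f1 by the integrals of the approximations, and
those of f2 stay below the gap of f2. *)
Lemma neg_entropy_gap_le f1 f2 : bounded_density f1 -> bounded_density f2 ->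
  (forall a, 1 < a -> (\int[mu]_x (f2 x `^ a)%:E <= \int[mu]_x (f1 x `^ a)%:E)%E) ->
  (neg_entropy_gap f1 <= neg_entropy_gap f2)%E.
Proof.
move=> bf1 bf2 f12; have [mf1 f10 fC1 _] := bf1; have [mf2 f20 fC2 _] := bf2.
have gle k : (\int[mu]_x (diffquot_gap f1 k x)%:E <= \int[mu]_x (diffquot_gap f2 k x)%:E)%E.
  have a1 : 1 < 1 + k.+1%:R^-1 :> R by rewrite ltrDl invr_gt0.
  have := integral_diffquot_gap k bf1; have := integral_diffquot_gap k bf2; have := f12 _ a1.
  set j1 := (\int[mu]_x (f1 x `^ _)%:E)%E; set j2 := (\int[mu]_x (f2 x `^ _)%:E)%E.
  set g1 := (\int[mu]_x (diffquot_gap f1 k x)%:E)%E.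
  set g2 := (\int[mu]_x (diffquot_gap f2 k x)%:E)%E.
  have g10 : (0 <= g1)%E by apply: integral_ge0 => x _; rewrite lee_fin diffquot_gap_ge0.
  have g20 : (0 <= g2)%E by apply: integral_ge0 => x _; rewrite lee_fin diffquot_gap_ge0.
  have k0 : (0 <= k.+1%:R%:E :> \bar R)%E by rewrite lee_fin.
  have j10 : (0 <= k.+1%:R%:E * j1)%E.
    by apply: mule_ge0 => //; apply: integral_ge0 => x _; rewrite lee_fin powR_ge0.
  have j20 : (0 <= k.+1%:R%:E * j2)%E.
    by apply: mule_ge0 => //; apply: integral_ge0 => x _; rewrite lee_fin powR_ge0.
  move=> /(lee_wpmul2l k0).
  move: j10 j20; move: (_ * j1)%E (_ * j2)%E => {}j1 {}j2.
  move: g1 g2 j1 j2 g10 g20 => [g1| |] [g2| |] [j1| |] [j2| |] //=.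
  move=> _ _ _ _ j21 [E2] [E1]; rewrite lee_fin; move: j21; rewrite lee_fin => j21.
  lra.
have g2le k : (\int[mu]_x (diffquot_gap f2 k x)%:E <= neg_entropy_gap f2)%E.
  apply: ge0_le_integral => //.
  - by move=> x _; rewrite lee_fin diffquot_gap_ge0.
  - by apply/measurable_EFinP; exact: measurable_diffquot_gap.
  - apply/measurable_EFinP; apply: measurable_funB; first exact: measurable_funM.
    exact: measurable_xlnx.
  - move=> x _; rewrite lee_fin /diffquot_gap lerD2l lerN2 ler_wpM2l ?(ltW (f20 x))//.
    exact: powR_sub1_ge.
have lim x : limn_einf (fun k => (diffquot_gap f1 k x)%:E) = (K * f1 x - f1 x * ln (f1 x))%:E.
  have H : (diffquot_gap f1 k x)%:E @[k --> \oo] --> (K * f1 x - f1 x * ln (f1 x))%:E.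
    apply: cvg_EFin; first exact: nearW.
    rewrite /comp /=; apply: cvgB; first exact: cvg_cst.
    by apply: cvgMl_tmp; exact: cvg_powR_sub1.
  by rewrite is_cvg_limn_einfE; [exact/cvg_lim|apply/cvg_ex; eexists; exact: H].
rewrite {1}/neg_entropy_gap.
under eq_integral do rewrite -lim.
apply: le_trans (fatou mu measurableT _ _) _.
- by move=> k; apply/measurable_EFinP; exact: measurable_diffquot_gap.
- by move=> k x _; rewrite lee_fin diffquot_gap_ge0.
rewrite limn_einf_lim; apply: lime_le; first exact: is_cvg_einfs.
apply: nearW => k; apply: (@le_trans _ _ (\int[mu]_x (diffquot_gap f1 k x)%:E)%E).
  by apply: ereal_inf_lbound; exists k => /=.
exact: le_trans (gle k) (g2le k).
Qed.

(** The positive part of f ln f is integrable, so the Shannon entropy exists, and it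
is the gap minus K. *)
Lemma shannon_gap f : bounded_density f ->
  let h x := (f x * ln (f x))%:E in
  [/\ (\int[mu]_x h^\+ x < +oo)%E &
      ((- (\int[mu]_x h x))%E = (neg_entropy_gap f - K%:E)%E)].
Proof.
move=> bf h; have [mf f0 fC f1] := bf.
have mh : measurable_fun setT h by apply/measurable_EFinP; exact: measurable_xlnx.
have mKf : measurable_fun setT (fun x => (K * f x)%:E).
  by apply/measurable_EFinP; exact: measurable_funM.
have IK : (\int[mu]_x (K * f x)%:E = K%:E)%E.
  under eq_integral do rewrite EFinM.
  rewrite ge0_integralZl_EFin ?xlnx_const_ge0// ?f1 ?mule1//.
  - by move=> x _; rewrite lee_fin (ltW (f0 x)).
  - by apply/measurable_EFinP.
have pK : (\int[mu]_x h^\+ x <= K%:E)%E.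
  rewrite -IK; apply: ge0_le_integral => //.
  - exact: measurable_funepos.
  - move=> x _; rewrite funeposE ge_max lee_fin; apply/andP; split.
      by rewrite -subr_ge0 neg_entropy_gap_ge0.
    by rewrite lee_fin mulr_ge0 ?xlnx_const_ge0// ltW.
have p0 : (0 <= \int[mu]_x h^\+ x)%E by apply: integral_ge0 => x _; exact: funepos_ge0.
split; first by rewrite (le_lt_trans pK)// ltry.
have E : ((\int[mu]_x h^\- x) + K%:E = neg_entropy_gap f + \int[mu]_x h^\+ x)%E.
  rewrite -IK /neg_entropy_gap -!ge0_integralD//; first last.
  - by move=> x _; rewrite lee_fin mulr_ge0 ?xlnx_const_ge0// ltW.
  - exact: measurable_funeneg.
  - exact: measurable_funepos.
  - apply/measurable_EFinP; apply: measurable_funB.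
      exact: measurable_funM.
    exact: measurable_xlnx.
  - by move=> x _; rewrite lee_fin neg_entropy_gap_ge0.
  apply: eq_integral => x _; rewrite funeposE funenegE /h -EFinN -!EFin_max -!EFinD; congr EFin.
  by move: (f x * ln (f x)) => v; have [v0|v0] := leP v 0; have [w0|w0] := leP (- v) 0; lra.
have n0 : (0 <= \int[mu]_x h^\- x)%E by apply: integral_ge0 => x _; exact: funeneg_ge0.
have N0 : (0 <= neg_entropy_gap f)%E.
  by apply: integral_ge0 => x _; rewrite lee_fin neg_entropy_gap_ge0.
rewrite [in LHS]integralE.
move: E pK p0 n0 N0; move: (\int[mu]_x h^\+ x)%E (\int[mu]_x h^\- x)%E (neg_entropy_gap f).
move=> [p| |] [q| |] [N| |] //= [] //; rewrite ?lee_fin//.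
by move=> E _ _ _ _; congr EFin; lra.
Qed.

End shannon.

(** * Order infinity: the essential supremum *)
Section order_infinity.
Context d (T : measurableType d) (R : realType) (mu : {measure set T -> \bar R}).
Implicit Types (f : T -> R).

Lemma bounded_density_powR_le (C M a : R) f : bounded_density mu C f -> 1 <= a ->
  0 <= M -> (\forall x \ae mu, ((f x)%:E <= M%:E)%E) ->
  (\int[mu]_x (f x `^ a)%:E <= (M `^ (a - 1))%:E)%E.
Proof.
move=> [mf f0 fC f1] a1 M0 fM.
rewrite -[X in (_ <= X)%E]mule1 -f1 -ge0_integralZl_EFin ?powR_ge0//; first last.
- by apply/measurable_EFinP.
- by move=> x _; rewrite lee_fin (ltW (f0 x)).
apply: ae_ge0_le_integral => //.
- by move=> x _; rewrite lee_fin powR_ge0.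
- by apply/measurable_EFinP; exact: (measurableT_comp (measurable_powR _) mf).
- by move=> x _; rewrite -EFinM lee_fin mulr_ge0 ?powR_ge0// ltW.
- by apply/measurable_EFinP; exact: measurable_funM.
apply: filterS fM => x + _; rewrite lee_fin => fM.
rewrite -EFinM lee_fin -(powR_mul1 a (f0 x)) ler_wpM2r ?(ltW (f0 x))//.
by apply: ge0_ler_powR; rewrite ?nnegrE ?subr_ge0// ltW.
Qed.

Lemma markov_powR (C m a : R) f : bounded_density mu C f -> 0 <= a -> 0 < m ->
  ((m `^ a)%:E * mu [set x | (m < f x)%R] <= \int[mu]_x (f x `^ a)%:E)%E.
Proof.
move=> [mf f0 fC f1] a0 m0.
have mE : measurable [set x | m < f x].
  rewrite -[X in measurable X]setTI (_ : [set x | m < f x] = f @^-1` `]m, +oo[%classic).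
    by apply: mf.
  by apply/seteqP; split => x /=; rewrite in_itv/= andbT.
rewrite -integral_cst//.
apply: (@le_trans _ _ (\int[mu]_(x in [set x | (m < f x)%R]) (f x `^ a)%:E)%E).
  apply: ge0_le_integral => //.
  - by move=> x _; rewrite lee_fin powR_ge0.
  - apply: measurable_funTS; apply/measurable_EFinP.
    exact: (measurableT_comp (measurable_powR _) mf).
  - move=> x /= mx; rewrite lee_fin; apply: ge0_ler_powR => //; rewrite ?nnegrE; try exact: ltW.
apply: ge0_subset_integral => //.
- by apply/measurable_EFinP; exact: (measurableT_comp (measurable_powR _) mf).
- by move=> x _; rewrite lee_fin powR_ge0.
Qed.

(** If m > M = ess sup f1, Markov's inequality gives
mu {f2 > m} <= M^(a-1) / m^a for all a > 1, hence mu {f2 > m} = 0. *)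
Lemma le_Lnorm_oo (C : R) f1 f2 : bounded_density mu C f1 -> bounded_density mu C f2 ->
  (forall a, 1 < a -> (\int[mu]_x (f2 x `^ a)%:E <= \int[mu]_x (f1 x `^ a)%:E)%E) ->
  (Lnorm mu +oo (EFin \o f2) <= Lnorm mu +oo (EFin \o f1))%E.
Proof.
move=> bf1 bf2 f12; have [mf1 f10 fC1 i1] := bf1; have [mf2 f20 fC2 i2] := bf2.
rewrite unlock; case: ifPn => // muT.
have Ef f : (forall x, 0 < f x) -> abse \o (EFin \o f) = EFin \o f.
  by move=> f0; apply/funext => x /=; rewrite gtr0_norm.
rewrite !Ef//; set M := ess_sup mu (EFin \o f1).
have aeM : \forall x \ae mu, ((EFin \o f1) x <= M)%E by exact: ess_sup_ge.
have M0 : (0 <= M)%E.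
  by apply: ess_sup_gee => //; apply: aeW => x; rewrite lee_fin ltW.
case: M M0 aeM => [M| |] // M0 aeM; last by rewrite leey.
rewrite lee_fin in M0.
apply/lee_addgt0Pr => e e0.
apply/ess_supP; pose m := M + e; have m0 : 0 < m by rewrite ltr_wpDl.
have mE : measurable [set x | m < f2 x].
  rewrite -[X in measurable X]setTI (_ : [set x | m < f2 x] = f2 @^-1` `]m, +oo[%classic).
    by apply: mf2.
  by apply/seteqP; split => x /=; rewrite in_itv/= andbT.
exists [set x | m < f2 x]; split => //; last first.
  by move=> x /=; rewrite -EFinD lee_fin => /negP; rewrite -ltNge.
have H k : (mu [set x | (m < f2 x)%R] <= (m^-1 * (M / m) ^+ k.+1)%:E)%E.
  have a1 : 1 < k.+2%:R :> R by rewrite ltr1n.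
  have m1 := markov_powR bf2 (ltW (lt_trans ltr01 a1)) m0.
  have m2 := bounded_density_powR_le bf1 (ltW a1) M0 aeM.
  have := le_trans m1 (le_trans (f12 _ a1) m2).
  rewrite (_ : k.+2%:R - 1 = k.+1%:R); last by rewrite -[k.+2%:R]natr1 addrK.
  rewrite !powR_mulrn// ?(ltW m0)// -lee_pdivlMl ?exprn_gt0// -EFinM.
  congr (_ <= _%:E)%E.
  by rewrite [m ^+ k.+2]exprS invfM expr_div_n -mulrA [X in m^-1 * X = _]mulrC.
have L : (m^-1 * (M / m) ^+ k.+1)%:E @[k --> \oo] --> (0 : \bar R).
  apply: cvg_EFin; first exact: nearW.
  rewrite -(mulr0 m^-1); apply: cvgMl_tmp.
  rewrite (cvg_shiftS (fun k => (M / m) ^+ k)).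
  apply: cvg_expr; rewrite ger0_norm ?divr_ge0 ?(ltW m0)//.
  by rewrite ltr_pdivrMr// mul1r ltrDl.
apply/eqP; rewrite eq_le measure_ge0 andbT.
have := cvg_lim _ L => <-//; apply: lime_ge; first by apply/cvg_ex; eexists; exact: L.
exact: nearW.
Qed.

End order_infinity.

(** * Entropies in terms of an explicit density *)
Section density_transfer.
Context d (Omega : measurableType d) (R : realType) (P : probability Omega R).
Variables (n : nat) (W : Omega -> 'rV[R]_n) (f : 'rV[R]_n -> R) (C : R).
Hypothesis Wf : is_density P W f.
Hypothesis f_gt0 : forall x, 0 < f x.
Hypothesis f_leC : forall x, f x <= C.
Notation mu := (lebesgue_rV R n).

Lemma is_density_integral1 : (\int[mu]_x (f x)%:E = 1)%E.
Proof.
have [_ _ H] := Wf; rewrite -H// preimage_setT.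
exact: (probability_setT P).
Qed.

Lemma is_density_bounded : bounded_density mu C f.
Proof. by have [mf _ _] := Wf; split => //; exact: is_density_integral1. Qed.

Lemma is_density_density : is_density P W (density P W).
Proof. by rewrite /density; apply: xgetPex; exists f. Qed.

(** Densities are unique almost everywhere, so entropies can be computed with any
version of the density. *)
Lemma density_ae : \forall x \ae mu, density P W x = f x.
Proof.
have [mf f0 fE] := Wf; have [mD D0 DE] := is_density_density.
have fi : mu.-integrable setT (EFin \o f).
  apply/integrableP; split; first exact/measurable_EFinP.
  under eq_integral => x _ do rewrite /= ger0_norm//.
  by rewrite is_density_integral1 ltry.
have mD' : measurable_fun setT (EFin \o density P W) by exact/measurable_EFinP.
have H : forall E : set 'rV[R]_n, E `<=` setT -> measurable E ->
    (\int[mu]_(x in E) (EFin \o f) x = \int[mu]_(x in E) (EFin \o density P W) x)%E.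
  by move=> E _ mE; rewrite /= -fE// DE.
have := integral_ae_eq measurableT fi mD' H.
by apply: filterS => x /(_ I) [->].
Qed.

Lemma integral_density (g : R -> R) : measurable_fun setT g ->
  (\int[mu]_x (g (density P W x))%:E = \int[mu]_x (g (f x))%:E)%E.
Proof.
move=> mg; have [mf _ _] := Wf; have [mD _ _] := is_density_density.
apply: ae_eq_integral => //.
- by apply/measurable_EFinP; exact: measurableT_comp.
- by apply/measurable_EFinP; exact: measurableT_comp.
- by apply: filterS density_ae => x -> _.
Qed.

(** A density that is positive everywhere has full support. *)
Lemma renyi_entropy0 : renyi_entropy P 0%E W = lne (mu setT).
Proof.
rewrite /renyi_entropy /= eqxx; congr lne.
have [mD _ _] := is_density_density.
have mE : measurable [set x | density P W x != 0].
  rewrite -[X in measurable X]setTI.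
  rewrite (_ : [set x | _] = density P W @^-1` (~` [set 0])); last first.
    by apply/seteqP; split => x /= /eqP.
  by apply: mD => //; exact: measurableC.
have [N [mN N0 subN]] := density_ae.
apply/eqP; rewrite eq_le; apply/andP; split; first by apply: le_measure; rewrite ?inE.
have le1 : (mu ([set x | (density P W x != 0)%R] `|` N) <=
    mu [set x | (density P W x != 0)%R])%E.
  apply: (le_trans (measureU2 _ mE mN)); rewrite -[X in (_ <= X)%E]adde0.
  by apply: leeD => //; rewrite le_eqVlt; apply/orP; left; apply/eqP; exact: N0.
apply: le_trans le1; apply: le_measure; rewrite ?inE//.
  exact: measurableU.
move=> x _; have [Dx|Dx] := pselect (density P W x = f x).
  by left; rewrite /= Dx gt_eqF.
by right; exact: subN.
Qed.

Lemma renyi_entropy_powR (a : R) : a != 0 -> a != 1 ->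
  renyi_entropy P a%:E W = ((1 - a)^-1%:E * lne (\int[mu]_x (f x `^ a)%:E))%E.
Proof.
move=> /negbTE a0 /negbTE a1; rewrite /renyi_entropy a0 a1; congr (_ * lne _)%E.
exact: (integral_density (measurable_powR a)).
Qed.

Lemma renyi_entropy1 : renyi_entropy P 1%E W = (- \int[mu]_x (f x * ln (f x))%:E)%E.
Proof.
rewrite /renyi_entropy oner_eq0 eqxx; congr (- _)%E.
apply: (@integral_density (fun t => t * ln t)).
by apply: measurable_funM => //; exact: measurable_ln.
Qed.

Lemma renyi_entropy_oo :
  renyi_entropy P +oo%E W = (- lne (Lnorm mu +oo (EFin \o f)))%E.
Proof.
rewrite /renyi_entropy; congr (- lne _)%E; rewrite unlock; case: ifPn => // _.
by apply: eq_ess_sup; apply: filterS density_ae => x /= ->.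
Qed.

Lemma shannon_integral_density :
  (\int[mu]_x (shannon_integrand P W)^\+ x =
   \int[mu]_x (fun x => (f x * ln (f x))%:E)^\+ x)%E.
Proof.
under eq_integral do rewrite funeposE /shannon_integrand -EFin_max.
under [RHS]eq_integral do rewrite funeposE -EFin_max.
apply: (@integral_density (fun t => Num.max (t * ln t) 0)).
apply: measurable_maxr => //.
by apply: measurable_funM => //; exact: measurable_ln.
Qed.

End density_transfer.

(** * From integrals of powers to entropies *)
Lemma smoothing_le1 d (Omega : measurableType d) (R : realType)
    (P : probability Omega R) n beta (Y : Omega -> 'rV[R]_n) u : 0 < beta ->
  measurable_fun setT Y -> smoothing P beta setT Y u <= 1.
Proof.
move=> b0 mY; rewrite -lee_fin smoothingE//.
have P1 : (\int[P]_w (cst 1%E w) = 1)%E.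
  by rewrite integral_cst// mul1e; exact: (probability_setT P).
rewrite -[X in (_ <= X)%E]P1; apply: ge0_le_integral => //.
- by move=> w _; rewrite lee_fin gauss_kernel_ge0.
- by apply/measurable_EFinP; exact: measurable_gauss_kernel.
- by move=> w _; rewrite lee_fin gauss_kernel_le1.
Qed.

Lemma smoothing_gt0 d (Omega : measurableType d) (R : realType)
    (P : probability Omega R) n beta (Y : Omega -> 'rV[R]_n) u : 0 < beta ->
  measurable_fun setT Y -> 0 < smoothing P beta setT Y u.
Proof.
move=> b0 mY; rewrite lt0r smoothing_ge0 andbT; apply/eqP => s0.
have mk : measurable_fun setT (fun w => (\1_[set: Omega] w * gauss beta (u - Y w))%:E).
  by apply/measurable_EFinP; exact: measurable_gauss_kernel.
have I0 : (\int[P]_w `|(\1_[set: Omega] w * gauss beta (u - Y w))%:E| = 0)%E.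
  under eq_integral do rewrite gee0_abs ?lee_fin ?gauss_kernel_ge0//.
  by rewrite -smoothingE// s0.
have [N [mN N0 subN]] := (ae_eq_integral_abs P measurableT mk).1 I0.
have : (P [set: Omega] <= P N)%E.
  apply: le_measure; rewrite ?inE// => w _; apply: subN => /= /(_ I) /eqP.
  by rewrite indicT mul1r eqe gt_eqF// gauss_gt0.
rewrite N0 leNgt => /negP; apply.
have -> : P [set: Omega] = 1%E by exact: (probability_setT P).
exact: lte01.
Qed.

Lemma le_lne (R : realType) (x y : \bar R) :
  (0 <= x)%E -> (x <= y)%E -> (lne x <= lne y)%E.
Proof.
move=> x0 xy; rewrite lee_lne// in_itv/= leey andbT//.
exact: le_trans xy.
Qed.

Lemma lee_nmul_lne (R : realType) (c : R) (x y : \bar R) :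
  c < 0 -> (0 <= x)%E -> (x <= y)%E -> (c%:E * lne y <= c%:E * lne x)%E.
Proof.
move=> c0 x0 xy; rewrite -[c]opprK EFinN !mulNe leeN2.
by apply: lee_wpmul2l; [rewrite lee_fin oppr_ge0 ltW|exact: le_lne].
Qed.

Lemma lee_pmul_lne (R : realType) (c : R) (x y : \bar R) :
  0 <= c -> (0 <= x)%E -> (x <= y)%E -> (c%:E * lne x <= c%:E * lne y)%E.
Proof. by move=> c0 x0 xy; apply: lee_wpmul2l; [rewrite lee_fin|exact: le_lne]. Qed.

Section entropy_comparison.
Context d (Omega : measurableType d) (R : realType) (P : probability Omega R).
Variables (n : nat) (W1 W2 : Omega -> 'rV[R]_n) (f1 f2 : 'rV[R]_n -> R) (C : R).
Hypothesis C1 : 1 <= C.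
Hypothesis (Wf1 : is_density P W1 f1) (Wf2 : is_density P W2 f2).
Hypothesis (f1_gt0 : forall x, 0 < f1 x) (f2_gt0 : forall x, 0 < f2 x).
Hypothesis (f1_leC : forall x, f1 x <= C) (f2_leC : forall x, f2 x <= C).
Notation mu := (lebesgue_rV R n).
Hypothesis le_gt1 : forall a, 1 < a ->
  (\int[mu]_x (f2 x `^ a)%:E <= \int[mu]_x (f1 x `^ a)%:E)%E.
Hypothesis le_lt1 : forall a, 0 < a -> a < 1 ->
  (\int[mu]_x (f1 x `^ a)%:E <= \int[mu]_x (f2 x `^ a)%:E)%E.

Let bf1 := is_density_bounded Wf1 f1_gt0 f1_leC.
Let bf2 := is_density_bounded Wf2 f2_gt0 f2_leC.

Let int_powR_ge0 f (a : R) : (0 <= \int[mu]_x ((f x : R) `^ a)%:E)%E.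
Proof. by apply: integral_ge0 => x _; rewrite lee_fin powR_ge0. Qed.

Lemma shannon_entropy_le : (renyi_entropy P 1%E W1 <= renyi_entropy P 1%E W2)%E.
Proof.
have [_ G1] := shannon_gap C1 bf1; have [_ G2] := shannon_gap C1 bf2.
rewrite (etrans (renyi_entropy1 Wf1) G1) (etrans (renyi_entropy1 Wf2) G2).
by apply: leeB => //; exact: (neg_entropy_gap_le C1 bf1 bf2 le_gt1).
Qed.

Lemma renyi_entropy_le_ge1 (a : \bar R) : (1 <= a)%E ->
  (renyi_entropy P a W1 <= renyi_entropy P a W2)%E.
Proof.
case: a => [a| |]; last by rewrite leeNy_eq.
- rewrite lee_fin le_eqVlt => /predU1P[<-|a1]; first exact: shannon_entropy_le.
  have a0 : a != 0 by rewrite gt_eqF// (lt_trans ltr01).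
  have aN1 : a != 1 by rewrite gt_eqF.
  rewrite (renyi_entropy_powR Wf1 a0 aN1) (renyi_entropy_powR Wf2 a0 aN1).
  apply: lee_nmul_lne; first by rewrite invr_lt0 subr_lt0.
    exact: int_powR_ge0.
  exact: le_gt1.
- move=> _; rewrite (renyi_entropy_oo Wf1) (renyi_entropy_oo Wf2) leeN2.
  apply: le_lne; first exact: Lnorm_ge0.
  exact: (le_Lnorm_oo bf1 bf2 le_gt1).
Qed.

Lemma renyi_entropy_le_lt1 (a : \bar R) : (0 <= a)%E -> (a < 1)%E ->
  (renyi_entropy P a W1 <= renyi_entropy P a W2)%E.
Proof.
case: a => [a| |]; [|by move=> _; rewrite ltNge leey|by rewrite leeNy_eq].
rewrite lee_fin lte_fin le_eqVlt => /predU1P[<- _|a0 a1].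
  by rewrite (renyi_entropy0 Wf1 f1_gt0) (renyi_entropy0 Wf2 f2_gt0).
have aN0 : a != 0 by rewrite gt_eqF.
have aN1 : a != 1 by rewrite lt_eqF.
rewrite (renyi_entropy_powR Wf1 aN0 aN1) (renyi_entropy_powR Wf2 aN0 aN1).
apply: lee_pmul_lne; first by rewrite invr_ge0 subr_ge0 ltW.
  exact: int_powR_ge0.
exact: le_lt1.
Qed.

End entropy_comparison.

Lemma shannon_entropy_gtNy d (Omega : measurableType d) (R : realType)
    (P : probability Omega R) n (W : Omega -> 'rV[R]_n) (f : 'rV[R]_n -> R) (C : R) :
  1 <= C -> is_density P W f -> (forall x, 0 < f x) -> (forall x, f x <= C) ->
  shannon_integral_exists P W /\ (-oo < renyi_entropy P 1%E W)%E.
Proof.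
move=> C1 Wf f0 fC; have bf := is_density_bounded Wf f0 fC.
have [H1 H2] := shannon_gap C1 bf; split.
  by left; rewrite (shannon_integral_density Wf).
rewrite (renyi_entropy1 Wf) H2.
have : (0 <= neg_entropy_gap (lebesgue_rV R n) C f)%E.
  by apply: integral_ge0 => x _; rewrite lee_fin (neg_entropy_gap_ge0 C1 x bf).
by case: (neg_entropy_gap _ _ _) => [r _| |] //; rewrite -EFinB ltNyr.
Qed.

Lemma independent_RV_comp d (Omega : measurableType d) (R : realType)
    (P : probability Omega R) n (T : 'rV[R]_n -> 'rV[R]_n) (X Z : Omega -> 'rV[R]_n) :
  measurable_fun setT T -> independent_RV P X Z -> independent_RV P (T \o X) Z.
Proof.
move=> mT XZ A B mA mB; rewrite comp_preimage; apply: XZ => //.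
by rewrite -[X in measurable X]setTI; exact: mT.
Qed.

Lemma integral_peak_powR d (Omega : measurableType d) (R : realType)
    (P : probability Omega R) n (s beta a : R) (Y : Omega -> 'rV[R]_n) :
  0 < s -> 0 < beta -> measurable_fun setT Y ->
  (\int[lebesgue_rV R n]_u ((peak n s * smoothing P beta setT Y u) `^ a)%:E =
   (peak n s `^ a)%:E * \int[lebesgue_rV R n]_u (smoothing P beta setT Y u `^ a)%:E)%E.
Proof.
move=> s0 b0 mY; rewrite -ge0_integralZl_EFin ?powR_ge0//; first last.
- apply/measurable_EFinP; apply: (measurableT_comp (measurable_powR a)).
  by apply: measurable_smoothing.
- by move=> u _; rewrite lee_fin powR_ge0.
apply: eq_integral => u _; rewrite -EFinM powRM ?smoothing_ge0//.
by apply: ltW; exact: peak_gt0.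
Qed.

Theorem theorem1p5 (R : realType) (n : nat) (T : 'rV[R]_n -> 'rV[R]_n)
    (T_lip : lipschitz1 T)
    (d : measure_display) (Omega : measurableType d) (P : probability Omega R)
    (X Z : {RV P >-> 'rV[R]_n})
    (Z_gauss : standard_gaussian P Z) (XZ_indep : independent_RV P X Z)
    (s : R) (s_gt0 : 0 < s) :
  let U := fun w => X w + Num.sqrt s *: Z w in
  let V := fun w => T (X w) + Num.sqrt s *: Z w in
  [/\ has_density P U /\ has_density P V,
      forall a : \bar R, (1 <= a)%E ->
        (renyi_entropy P a V <= renyi_entropy P a U)%E,
      ('E_P[fun w => norm2 (X w)] < +oo)%E ->
        forall a : \bar R, (0 <= a)%E -> (a < 1)%E ->
          (renyi_entropy P a V <= renyi_entropy P a U)%E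
    & [/\ shannon_integral_exists P U, shannon_integral_exists P V,
          (-oo < renyi_entropy P 1%E U)%E & (-oo < renyi_entropy P 1%E V)%E]].
Proof.
move=> U V.
have mX : measurable_fun setT X by exact: measurable_funPT.
have mT : measurable_fun setT T.
  exact: (measurable_lipschitz_comp T_lip (@measurable_id _ _ setT)).
have mTX : measurable_fun setT (T \o X) by exact: measurableT_comp.
pose Y : {RV P >-> 'rV[R]_n} := HB.pack (T \o X) (isMeasurableFun.Build _ _ _ _ _ mTX).
have b0 : 0 < (2 * s)^-1 by rewrite invr_gt0 mulr_gt0.
pose fU u := peak n s * smoothing P (2 * s)^-1 setT X u.
pose fV u := peak n s * smoothing P (2 * s)^-1 setT Y u.
have dU : is_density P U fU by exact: is_density_smoothing.
have dV : is_density P V fV.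
  exact: (@is_density_smoothing _ _ _ P n Y Z s s_gt0 Z_gauss (independent_RV_comp mT XZ_indep)).
have pk := peak_gt0 n s_gt0.
have fU0 u : 0 < fU u by rewrite mulr_gt0// smoothing_gt0.
have fV0 u : 0 < fV u by rewrite mulr_gt0// smoothing_gt0.
pose C := Num.max 1 (peak n s).
have C1 : 1 <= C by rewrite le_max lexx.
have le_C (k t : R) : 0 < k -> t <= 1 -> k * t <= Num.max 1 k.
  move=> k0 t1; rewrite (@le_trans _ _ k)// ?ler_piMr ?(ltW k0)//.
  by rewrite le_max lexx orbT.
have fUC u : fU u <= C by apply: le_C => //; exact: smoothing_le1.
have fVC u : fV u <= C by apply: le_C => //; exact: smoothing_le1.
have cmp a : 0 < a -> _ := @contraction_powR _ _ _ P n _ T X b0 T_lip mX a.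
have le_scale (k x y x' y' : \bar R) : (0 <= k)%E -> x' = (k * x)%E -> y' = (k * y)%E ->
    (x <= y)%E -> (x' <= y')%E by move=> k0 -> ->; exact: lee_wpmul2l.
have EU a := integral_peak_powR P a s_gt0 b0 mX.
have EV a := integral_peak_powR P a s_gt0 b0 mTX.
have k0 a : (0 <= (peak n s `^ a)%:E)%E by rewrite lee_fin powR_ge0.
have le_gt1 a : 1 < a -> (\int[lebesgue_rV R n]_x (fU x `^ a)%:E <=
    \int[lebesgue_rV R n]_x (fV x `^ a)%:E)%E.
  move=> a1; have H := (cmp a (lt_trans ltr01 a1)).1 (ltW a1).
  exact: (le_scale _ _ _ _ _ (k0 a) (EU a) (EV a) H).
have le_lt1 a : 0 < a -> a < 1 -> (\int[lebesgue_rV R n]_x (fV x `^ a)%:E <=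
    \int[lebesgue_rV R n]_x (fU x `^ a)%:E)%E.
  move=> a0 a1; have H := (cmp a a0).2 (ltW a1).
  exact: (le_scale _ _ _ _ _ (k0 a) (EV a) (EU a) H).
have [sU hU] := shannon_entropy_gtNy C1 dU fU0 fUC.
have [sV hV] := shannon_entropy_gtNy C1 dV fV0 fVC.
split.
- by split; [exists fU|exists fV].
- exact: (renyi_entropy_le_ge1 C1 dV dU fV0 fU0 fVC fUC le_gt1).
- by move=> _; exact: (renyi_entropy_le_lt1 dV dU fV0 fU0 le_lt1).
- by split; [exact: sU|exact: sV|exact: hU|exact: hV].
Qed.
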